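(* Let $H\in(0,1)$, let $(B^H_t)_{t\ge0}$ be a fractional Brownian motion with Hurst parameter $H$, and let $X_0$ be a real random variable independent of $(B^H_t)_{t\ge0}$ with finite second moment. Let $X_t=X_0+B^H_t$ for $t\ge0$. Then for every $t>0$, $$\frac{d}{dt}h(X_t)=Ht^{2H-1}J_1(X_t),$$ where $h$ is the Shannon entropy and $J_1$ is the Fisher information. In particular, if $X_0$ is Gaussian with mean $0$ and variance $\sigma_0^2$, then for every $t>0$, $$\frac{d}{dt}h(X_t)=\frac{Ht^{2H-1}}{\sigma_0^2+t^{2H}}.$$
   Context: A fractional Brownian motion $(B^H_t)_{t\ge0}$ with Hurst parameter $H\in(0,1)$ is a centered Gaussian process with stationary increments and covariance $\mathbb{E}[B^H_sB^H_t]=\tfrac12(t^{2H}+s^{2H}-|t-s|^{2H})$. For a random variable $X$ with probability density $f_X$, the Shannon entropy is $h(X):=-\mathbb{E}[\ln f_X(X)]=-\int_{\mathbb{R}}f_X(x)\ln f_X(x)\,dx$, and the (classical) Fisher information is $J_1(X):=\mathbb{E}\big[\big(\tfrac{\partial}{\partial x}\ln f_X(X)\big)^2\big]$, where the derivative of $\ln f_X$ is evaluated at $X$. *)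

(* Defs.v *)
From HB Require Import structures.
From mathcomp Require Import all_boot all_order all_algebra.
From mathcomp Require Import all_classical all_reals all_analysis.

Set Implicit Arguments.
Unset Strict Implicit.
Unset Printing Implicit Defensive.

Import Order.TTheory GRing.Theory Num.Theory.
Import numFieldNormedType.Exports.

Local Open Scope classical_set_scope.
Local Open Scope ring_scope.

Section processes.
Context d (T : measurableType d) (R : realType) (P : probability T R).

(* [normal_prob m 0] is the uniform law on [0, 1], so the degenerate Gaussian
   (variance 0) has to be given separately, as a Dirac mass. *)
Definition is_gaussian (X : T -> R) (m s : R) : Prop :=
  forall A : set R, measurable A ->
    P (X @^-1` A) = if s == 0 then \d_m A else normal_prob m s A.

(* Processes indexed by [0, +oo[ are families indexed by R of which only the
   members with nonnegative index are ever constrained. *)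
Implicit Type B : R -> {RV P >-> R}.

Definition gaussian_process B : Prop :=
  forall (n : nat) (t a : 'I_n -> R), (forall i, 0 <= t i) ->
    exists m s : R, is_gaussian (fun w => \sum_(i < n) a i * B (t i) w) m s.

Definition centered_process B : Prop :=
  forall t : R, 0 <= t -> ('E_P[B t] = 0)%E.

Definition stationary_increments B : Prop :=
  forall (h : R) (n : nat) (t : 'I_n -> R) (A : 'I_n -> set R),
    0 <= h -> (forall i, 0 <= t i) -> (forall i, measurable (A i)) ->
    P [set w | forall i, A i (B (h + t i) w - B h w)] =
    P [set w | forall i, A i (B (t i) w - B 0 w)].

Definition fractional_brownian_motion (H : R) B : Prop :=
  [/\ gaussian_process B,
      centered_process B,
      stationary_increments B &
      forall s t : R, 0 <= s -> 0 <= t ->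
        ('E_P[fun w => (B s w * B t w)%R] =
         ((t `^ (2 * H) + s `^ (2 * H) - `|t - s| `^ (2 * H)) / 2)%:E)%E].

Definition sigma_process B : set_system T :=
  <<s \bigcup_(t in [set t : R | 0 <= t]) g_sigma_algebra_preimage (B t) >>.

Definition independent_of_process (X : {RV P >-> R}) B : Prop :=
  forall (E F : set T), g_sigma_algebra_preimage X E -> sigma_process B F ->
    (P (E `&` F) = P E * P F)%E.

End processes.

Section information.
Context d (T : measurableType d) (R : realType) (P : probability T R).
Implicit Types (X : T -> R) (f : R -> R).

Definition is_density X f : Prop :=
  [/\ measurable_fun setT f,
      (forall x, 0 <= f x) &
      forall A : set R, measurable A ->
        P (X @^-1` A) = (\int[lebesgue_measure]_(x in A) (f x)%:E)%E].

Definition is_differentiable_density X f : Prop :=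
  is_density X f /\ forall x : R, derivable f x 1.

(* A density is only determined up to a null set, whereas the Fisher information
   differentiates it pointwise: the differentiable version, which is unique, is
   taken whenever there is one. *)
Definition density X : R -> R :=
  if `[< exists f, is_differentiable_density X f >]
  then get (is_differentiable_density X)
  else get (is_density X).

Definition shannon_entropy X : \bar R :=
  (- 'E_P[fun w => ln (density X (X w))])%E.

Definition fisher_information X : \bar R :=
  ('E_P[fun w => ((derive1 (fun x => ln (density X x)) (X w)) ^+ 2)%R])%E.

End information.

(* Main.v *)
Require Import Defs.
From HB Require Import structures.
From mathcomp Require Import all_boot all_order all_algebra.
From mathcomp Require Import all_classical all_reals all_analysis.
From mathcomp Require Import measurable_realfun.
From mathcomp Require Import ring lra.

Set Implicit Arguments.
Unset Strict Implicit.
Unset Printing Implicit Defensive.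

Import Order.TTheory GRing.Theory Num.Theory.
Import numFieldNormedType.Exports.

Local Open Scope classical_set_scope.
Local Open Scope ring_scope.

(** Let [v = t `^ (2 * H)]. The variable [B t] has the centered normal law of
    variance [v], so by independence [X0 + B t] has the density
    [p v x = E (gauss v (x - X0))], a Gaussian mixture ([mixture]). Each
    [gauss v] solves the heat equation
      [d/dv gauss v = (1/2) * d^2/dx^2 (gauss v)],
    hence so does [p], and the entropy [- int p v * ln (p v)], as a function of
    [v], has the derivative
      [- (1/2) * int p'' * (1 + ln p) = (1/2) * int p' ^ 2 / p],
    where [p'] and [p''] are derivatives in [x] and the equality is an
    integration by parts. This is the identity of de Bruijn ([de_bruijn]); the
    theorem is its composition with [t |-> t `^ (2 * H)].

    The analysis consists in dominating every integrand, locally uniformly in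
    [v], and all of them are dominated by multiples of one function, the envelope
    [E ((1 + X0 ^ 2) / (1 + (x - X0) ^ 2))]. By Tonelli's theorem it is
    integrable as soon as [X0] has a second moment ([integrable_envelope]), and it
    tends to [0] at infinity, which disposes of the boundary terms
    ([cvg_envelope]). The domination has three ingredients: [gauss v] and its
    derivatives decay faster than any power, so that their means against the law
    of [X0] stay below the envelope even when multiplied by [1 + x ^ 2]
    ([smooth_envelope]); Jensen's inequality bounds [ln p] below by a quadratic
    polynomial ([ln_mixture_bound]); and the Cauchy-Schwarz inequality controls
    [p' ^ 2 / p] by the mean of [z ^ 2 / v ^ 2 * gauss v z]
    ([score_mixture_bound]).

    Entropy and Fisher information are computed from a chosen density. The choice
    can only be [p v], since two continuous densities of the same law coincide
    ([continuous_density_unique]).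

    When [X0] is itself centered normal with standard deviation [s0], the mixture
    is [gauss (s0 ^ 2 + v)], and the Fisher information of a normal law is the
    inverse of its variance. *)

(** * The centered Gaussian kernel *)

Section gaussian_kernel.
Context {R : realType}.
Implicit Types (v z a b : R).

(** The density of the centered normal law of variance [v]; the normalizing
    constant sits in the exponent, so that differentiating in [v] and bounding
    below are questions about an exponent. *)
Definition gauss v z := expR (- ((z ^+ 2 / v + ln (pi *+ 2 * v)) / 2)).
Definition gauss1 v z := - (z / v) * gauss v z.
Definition gauss2 v z := (z ^+ 2 / v ^+ 2 - v^-1) * gauss v z.

Lemma gauss_gt0 v z : 0 < gauss v z.
Proof. exact: expR_gt0. Qed.

Lemma is_derive_gauss v z : is_derive z 1 (gauss v) (gauss1 v z).
Proof.
have H : is_derive z 1 (fun z => - ((z ^+ 2 / v + ln (pi *+ 2 * v)) / 2))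
    (- (z / v)).
  by apply: is_derive_eq; rewrite /GRing.scale/=; set w := v^-1; field.
rewrite /gauss1 mulrC.
exact: (is_derive1_comp (is_derive_expR _) H).
Qed.

Lemma is_derive_gauss1 v z : is_derive z 1 (gauss1 v) (gauss2 v z).
Proof.
have H := is_derive_gauss v z.
have -> : gauss1 v = fun z => - (z / v) * gauss v z by [].
apply: is_derive_eq; rewrite /GRing.scale/= /gauss2 /gauss1 -exprVn; ring.
Qed.

(** The heat equation. *)
Lemma is_derive_gauss_variance v z : 0 < v ->
  is_derive v 1 (gauss ^~ z) (gauss2 v z / 2).
Proof.
move=> v0; have vN0 : v != 0 by rewrite gt_eqF.
have piN0 : pi != 0 :> R by rewrite gt_eqF// pi_gt0.
have c0 : 0 < pi *+ 2 * v :> R by rewrite mulr_gt0// mulrn_wgt0// pi_gt0.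
have Hc : is_derive v 1 (fun v => pi *+ 2 * v) (pi *+ 2 : R).
  by apply: is_derive_eq; rewrite /GRing.scale/=; ring.
have Hl : is_derive v 1 (fun v => ln (pi *+ 2 * v)) v^-1.
  have -> : v^-1 = (pi *+ 2 * v)^-1 * (pi *+ 2).
    by rewrite invfM mulrAC mulVf ?mul1r// mulrn_eq0.
  exact: (is_derive1_comp (is_derive1_ln c0) Hc).
have Hi : is_derive v 1 (fun v => z ^+ 2 / v) (- (z ^+ 2 / v ^+ 2)).
  have Hv := is_deriveV (f := id) vN0 (is_derive_id v 1).
  by have := is_deriveZ (z ^+ 2) Hv; rewrite /GRing.scale/= mulr1 mulrN.
have Hs := is_deriveD Hi Hl.
have H : is_derive v 1 (fun v => - ((z ^+ 2 / v + ln (pi *+ 2 * v)) / 2))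
    ((z ^+ 2 / v ^+ 2 - v^-1) / 2).
  by apply: is_derive_eq; rewrite /GRing.scale/=; field.
have -> : gauss2 v z / 2 = gauss v z * ((z ^+ 2 / v ^+ 2 - v^-1) / 2).
  by rewrite /gauss2; ring.
exact: (is_derive1_comp (is_derive_expR _) H).
Qed.

Lemma normal_pdf_gauss (m s x : R) : s != 0 ->
  normal_pdf m s x = gauss (s ^+ 2) (x - m).
Proof.
move=> s0; rewrite normal_pdfE// /normal_peak /normal_fun /gauss.
have s20 : 0 < s ^+ 2 by rewrite exprn_even_gt0.
have c0 : 0 < pi *+ 2 * s ^+ 2 :> R by rewrite mulr_gt0// mulrn_wgt0// pi_gt0.
rewrite mulrDl opprD expRD mulrC; congr (expR _ * _).
  by field.
have E (p q : R) : q * p *+ 2 = p *+ 2 * q by ring.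
rewrite E.
rewrite expRN; congr (_^-1).
rewrite -powR12_sqrt ?(ltW c0)// /powR gt_eqF//.
by rewrite mulrC.
Qed.

(** The yardstick for kernels: it is integrable, so a kernel of order
    [decay ^+ 2] remains integrable against a weight of quadratic growth. *)
Definition decay z := (oneDsqr z)^-1.

Lemma decay_gt0 z : 0 < decay z.
Proof. by rewrite invr_gt0 (lt_le_trans ltr01)// oneDsqr_ge1. Qed.

Lemma decay_le1 z : decay z <= 1.
Proof. exact: (oneDsqrV_le1 z). Qed.

Lemma decayM_oneDsqr z : decay z * (1 + z ^+ 2) = 1.
Proof. by rewrite mulVf// gt_eqF// (lt_le_trans ltr01)// oneDsqr_ge1. Qed.

(** The exponential outgrows the polynomial by [1 + s <= expR s], applied to
    [s = z ^+ 2 / (6 * b)] and cubed: up to normalization, [expR (- (3 * s))] is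
    [gauss b z]. *)
Lemma gauss_decay a b : 0 < a -> exists C, 0 <= C /\
  forall v z, a <= v <= b -> gauss v z <= C * decay z ^+ 3.
Proof.
move=> a0; pose M := 1 + 6 * b; pose C0 := expR (- (ln (pi *+ 2 * a) / 2)).
exists (C0 * `|M| ^+ 3); split; first by rewrite mulr_ge0 ?expR_ge0 ?exprn_ge0.
move=> v z /andP[av vb]; have v0 := lt_le_trans a0 av.
have b0 := lt_le_trans v0 vb.
have pi2 : 0 < pi *+ 2 :> R by rewrite mulrn_wgt0// pi_gt0.
have M0 : 0 < M by rewrite /M; lra.
rewrite (gtr0_norm M0).
pose s := z ^+ 2 / (6 * b).
have s0 : 0 <= s by rewrite divr_ge0 ?sqr_ge0//; lra.
have zs : 1 + z ^+ 2 <= M * expR s.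
  have -> : z ^+ 2 = 6 * b * s by rewrite /s; field; rewrite gt_eqF.
  apply: (@le_trans _ _ (M * (1 + s))).
    by rewrite /M; nra.
  by rewrite ler_pM2l// expR_ge1Dx.
have h : gauss v z <= C0 * expR (- s) ^+ 3.
  rewrite /C0 -expRM_natl -expRD ler_expR mulrDl opprD addrC lerD//.
    rewrite lerN2 ler_pM2r ?invr_gt0// ler_ln ?posrE ?mulr_gt0//.
    by rewrite ler_pM2l.
  rewrite mulrN lerN2 /s.
  have -> : z ^+ 2 / v / 2 = z ^+ 2 * (2 * v)^-1 by field; rewrite gt_eqF.
  have -> : 3 * (z ^+ 2 / (6 * b)) = z ^+ 2 * (2 * b)^-1.
    by field; rewrite gt_eqF.
  by rewrite ler_wpM2l ?sqr_ge0// lef_pV2 ?posrE; lra.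
apply: (le_trans h); rewrite -mulrA ler_wpM2l ?expR_ge0// -exprMn.
apply: lerXn2r; rewrite ?nnegrE ?expR_ge0 ?mulr_ge0 ?(ltW M0) ?(ltW (decay_gt0 z))//.
rewrite expRN /decay ler_pdivlMr; last by rewrite (lt_le_trans ltr01)// oneDsqr_ge1.
by rewrite mulrC ler_pdivrMr ?expR_gt0.
Qed.

End gaussian_kernel.

(** * Means of a kernel along a random shift *)

Section differentiation.
Context {R : realType} d {Y : measurableType d} {mu : {measure set Y -> \bar R}}.

Lemma is_derive_Rintegral (f f' : R -> Y -> R) (G : Y -> R) (a u v : R) :
  u < a < v ->
  (forall x, u < x < v -> mu.-integrable setT (EFin \o f x)) ->
  (forall x y, u < x < v -> is_derive x 1 (f ^~ y) (f' x y)) ->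
  mu.-integrable setT (EFin \o G) ->
  (forall x y, u < x < v -> `|f' x y| <= G y) ->
  is_derive a 1 (fun x => \int[mu]_y f x y) (\int[mu]_y f' a y).
Proof.
move=> auv intf df intG ubG.
have in_itvI x : [set` `]u, v[] x -> u < x < v by rewrite /= in_itv.
have Ia : [set` `]u, v[] a by rewrite /= in_itv.
have dE x y : [set` `]u, v[] x -> derive1 (f ^~ y) x = f' x y.
  by move=> /in_itvI xuv; rewrite derive1E; case: (df x y xuv) => _ ->.
have intf' x : [set` `]u, v[] x -> mu.-integrable setT (EFin \o f x).
  by move=> /in_itvI; exact: intf.
have df' x y : [set` `]u, v[] x -> setT y -> derivable (f ^~ y) x 1.
  by move=> /in_itvI xuv _; case: (df x y xuv).
have G0 y : 0 <= G y by apply: le_trans (ubG a y auv).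
have ub' x y : [set` `]u, v[] x -> setT y -> `|partial1of2 f x y| <= G y.
  by move=> xuv _; rewrite /partial1of2 dE//; apply/ubG/in_itvI.
have h1 := derivable_under_integral measurableT Ia intf' df' G0 intG ub'.
have h2 := differentiation_under_integral measurableT Ia intf' df' G0 intG ub'.
apply: DeriveDef => //.
rewrite -derive1E h2; apply: eq_Rintegral => y _.
by rewrite /partial1of2 dE.
Qed.

End differentiation.

Section smoothing.
Context d {T : measurableType d} {R : realType} (P : probability T R).
Variable Y : T -> R.
Hypothesis mY : measurable_fun setT Y.
Implicit Types (k : R -> R) (x v z C : R).

Definition smooth k x := \int[P]_w k (x - Y w).

Lemma derive_continuous (f f' : R -> R) :
  (forall x, is_derive x 1 f (f' x)) -> continuous f.
Proof.
move=> df x; apply/differentiable_continuous/derivable1_diffP.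
by case: (df x).
Qed.

Lemma measurable_smooth k x : measurable_fun setT k ->
  measurable_fun setT (fun w => k (x - Y w)).
Proof. by move=> mk; apply: measurableT_comp => //; exact: measurable_funB. Qed.

Lemma integrable_smooth k C x : measurable_fun setT k ->
  (forall z, `|k z| <= C) -> P.-integrable setT (fun w => (k (x - Y w))%:E).
Proof.
move=> mk kC; apply: measurable_bounded_integrable => //.
- by rewrite ltey_eq fin_num_measure.
- exact: measurable_smooth.
- exists C; split; first exact: num_real.
  by move=> M CM w _ /=; rewrite (le_trans (kC _))// ltW.
Qed.

Lemma is_derive_smooth k (k' : R -> R) C x :
  (forall z : R, is_derive z 1 k (k' z)) ->
  (forall z, `|k z| <= C) -> (forall z, `|k' z| <= C) ->
  is_derive x 1 (smooth k) (smooth k' x).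
Proof.
move=> dk kC k'C.
have mk : measurable_fun setT k.
  by apply: continuous_measurable_fun; exact: derive_continuous dk.
apply: (@is_derive_Rintegral _ _ _ _ (fun x w => k (x - Y w))
  (fun x w => k' (x - Y w)) (fun=> C) x (x - 1) (x + 1)).
- by rewrite ltrBlDr ltrDl ltr01.
- by move=> u _; exact: integrable_smooth kC.
- move=> u w _; have -> : k' (u - Y w) = k' (u - Y w) * 1 by rewrite mulr1.
  apply: (@is_derive1_comp _ k (fun u => u - Y w)).
  by apply: is_derive_eq; rewrite subr0.
- exact: finite_measure_integrable_cst.
- by move=> u w _.
Qed.

Lemma continuous_smooth k C : continuous k -> (forall z, `|k z| <= C) ->
  continuous (smooth k).
Proof.
move=> ck kC x.
have mk : measurable_fun setT k by exact: continuous_measurable_fun.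
have Ix : x \in `]x - 1, x + 1[%classic.
  by rewrite inE/= in_itv/= ltrBlDr ltrDl ltr01.
apply: (@continuity_under_integral _ _ _ P (fun x w => k (x - Y w)) setT
  measurableT (x - 1) (x + 1) _ _ (fun=> C) _ _ x Ix).
- by move=> u _; exact: integrable_smooth kC.
- apply: aeW => w _ u _; apply: (@continuous_comp _ _ _ (fun u => u - Y w) k).
    by apply: cvgB; [exact: cvg_id|exact: cvg_cst].
  exact: ck.
- exact: finite_measure_integrable_cst.
- by move=> u _; apply: aeW => w _.
Qed.

Hypothesis Y2 : P.-integrable setT (fun w => (Y w ^+ 2)%:E).

(** The weight [1 + Y ^+ 2], integrable by the second moment of [Y], pays for
    replacing [x] by [x - Y] in a quadratic factor. *)
Definition envelope x := \int[P]_w ((1 + Y w ^+ 2) * decay (x - Y w)).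

Lemma continuous_decay : continuous (@decay R).
Proof. exact: continuous_oneDsqrV. Qed.

Lemma integrable_weight : P.-integrable setT (fun w => (1 + Y w ^+ 2)%:E).
Proof.
apply: (eq_integrable measurableT
  ((fun w => 1%:E) \+ (fun w => (Y w ^+ 2)%:E))%E) => //.
by apply: integrableD => //; exact: finite_measure_integrable_cst.
Qed.

Lemma weight_ge1 w : 1 <= 1 + Y w ^+ 2.
Proof. by rewrite lerDl sqr_ge0. Qed.

Lemma measurable_envelope_integrand x :
  measurable_fun setT (fun w => (1 + Y w ^+ 2) * decay (x - Y w)).
Proof.
apply: measurable_funM.
  by apply: measurable_funD => //; exact: measurable_funX.
apply: measurable_smooth; apply: continuous_measurable_fun.
exact: continuous_decay.
Qed.

Lemma envelope_integrand_le x w :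
  0 <= (1 + Y w ^+ 2) * decay (x - Y w) <= 1 + Y w ^+ 2.
Proof.
have := weight_ge1 w; have := decay_gt0 (x - Y w); have := decay_le1 (x - Y w).
by move=> h1 h2 h3; apply/andP; split; nra.
Qed.

Lemma integrable_envelope_integrand x :
  P.-integrable setT (fun w => ((1 + Y w ^+ 2) * decay (x - Y w))%:E).
Proof.
apply: le_integrable integrable_weight => //.
  by apply/measurable_EFinP; exact: measurable_envelope_integrand.
move=> w _ /=; have /andP[h1 h2] := envelope_integrand_le x w.
by rewrite lee_fin !ger0_norm// (le_trans h1).
Qed.

Lemma continuous_envelope : continuous envelope.
Proof.
move=> x.
have Ix : x \in `]x - 1, x + 1[%classic.
  by rewrite inE/= in_itv/= ltrBlDr ltrDl ltr01.
apply: (@continuity_under_integral _ _ _ P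
  (fun x w => (1 + Y w ^+ 2) * decay (x - Y w)) setT
  measurableT (x - 1) (x + 1) _ _ (fun w => 1 + Y w ^+ 2) _ _ x Ix).
- by move=> u _; exact: integrable_envelope_integrand.
- apply: aeW => w _ u _; apply: cvgM; first exact: cvg_cst.
  apply: (@continuous_comp _ _ _ (fun u => u - Y w) (@decay R)).
    by apply: cvgB; [exact: cvg_id|exact: cvg_cst].
  exact: continuous_decay.
- exact: integrable_weight.
- move=> u _; apply: aeW => w _; have /andP[h1 h2] := envelope_integrand_le u w.
  by rewrite ger0_norm.
Qed.

Lemma envelope_ge0 x : 0 <= envelope x.
Proof.
by apply: Rintegral_ge0 => w _; have /andP[] := envelope_integrand_le x w.
Qed.

(** Since [1 + x ^+ 2 <= 2 * (1 + (x - y) ^+ 2) * (1 + y ^+ 2)], one of the two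
    factors [decay] absorbs the quadratic weight, at the price of [1 + Y ^+ 2]. *)
Lemma smooth_envelope k C x : measurable_fun setT k -> 0 <= C ->
  (forall z, `|k z| <= C * decay z ^+ 2) ->
  `|smooth k x| * (1 + x ^+ 2) <= 2 * C * envelope x.
Proof.
move=> mk C0 kC.
have dec2 z : decay z ^+ 2 <= decay z.
  by have := decay_gt0 z; have := decay_le1 z; nra.
have dec1 z : decay z ^+ 2 <= 1.
  by rewrite (le_trans (dec2 z)) ?decay_le1.
have kC1 z : `|k z| <= C.
  by rewrite (le_trans (kC z))// ler_piMr.
have ik := integrable_smooth x mk kC1.
have x20 : 0 <= 1 + x ^+ 2 by rewrite addr_ge0 ?sqr_ge0.
apply: (@le_trans _ _ ((\int[P]_w `|k (x - Y w)|) * (1 + x ^+ 2))).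
  by rewrite ler_wpM2r// le_normr_Rintegral.
have ink : P.-integrable setT (EFin \o (fun w => `|k (x - Y w)|)).
  apply: (@integrable_smooth (fun z => `|k z|) C) => // z.
    exact: measurableT_comp.
  by rewrite normr_id.
rewrite -RintegralZr// /envelope -RintegralZl//; last first.
  exact: integrable_envelope_integrand.
apply: le_Rintegral => //.
- apply: (eq_integrable measurableT
    (fun w => ((1 + x ^+ 2)%:E * (`|k (x - Y w)|)%:E)%E)) => //.
    by move=> w _ /=; rewrite -EFinM mulrC.
  exact: integrableZl.
- apply: (eq_integrable measurableT (fun w =>
    ((2 * C)%:E * ((1 + Y w ^+ 2) * decay (x - Y w))%:E)%E)) => //.
  by apply: integrableZl => //; exact: integrable_envelope_integrand.
move=> w _.
have h : decay (x - Y w) ^+ 2 * (1 + x ^+ 2) <=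
    2 * ((1 + Y w ^+ 2) * decay (x - Y w)).
  rewrite expr2 -mulrA (mulrA 2) [leRHS]mulrC.
  rewrite ler_wpM2l ?(ltW (decay_gt0 _))//.
  have := decayM_oneDsqr (x - Y w); set D := decay _ => DE.
  have D0 : 0 < D by exact: decay_gt0.
  have hx : 1 + x ^+ 2 <= 2 * (1 + Y w ^+ 2) * (1 + (x - Y w) ^+ 2).
    have -> : 2 * (1 + Y w ^+ 2) * (1 + (x - Y w) ^+ 2) = 1 + x ^+ 2 +
      (1 + (x - 2 * Y w) ^+ 2 + 2 * (Y w * (x - Y w)) ^+ 2) by ring.
    by rewrite lerDl !addr_ge0 ?sqr_ge0// mulr_ge0 ?sqr_ge0.
  apply: (le_trans (ler_wpM2l (ltW D0) hx)).
  by rewrite mulrCA DE mulr1.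
apply: (le_trans (ler_wpM2r x20 (kC _))).
rewrite -[leLHS]mulrA [2 * C]mulrC -[leRHS]mulrA.
exact: ler_wpM2l.
Qed.

End smoothing.

(** * Integration over the line *)

Section lebesgue.
Context {R : realType}.
Notation mu := (@lebesgue_measure R).

Lemma cvg_normr_nat : `|n%:R : R| @[n --> \oo] --> +oo.
Proof. by under eq_fun do rewrite normr_nat; exact: cvgr_idn. Qed.

Lemma cvg_normr_natN : `|- n%:R : R| @[n --> \oo] --> +oo.
Proof. by under eq_fun do rewrite normrN; exact: cvg_normr_nat. Qed.

Local Open Scope ereal_scope.

Lemma measurable_decay : measurable_fun setT (@decay R).
Proof. by apply: continuous_measurable_fun; exact: continuous_decay. Qed.

Lemma lebesgue_measure_shift (y : R) (A : set R) : measurable A ->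
  pushforward mu ((fun x => x - y)%R : _ -> measurableTypeR R) A = mu A.
Proof.
move=> mA; apply/esym/lebesgue_measure_unique => //=; first exact: measurable_funB.
move=> ms _ [[a b]] _ <-.
rewrite /pushforward /=.
have -> : ((fun x => x - y)%R @^-1` [set` `]a, b]]) = [set` `](a + y)%R, (b + y)%R]].
  by apply/seteqP; split => x /=; rewrite !in_itv/= ltrBrDr lerBlDr.
rewrite !lebesgue_measure_itv/= !lte_fin ltrD2r.
case: (a < b)%R => //; rewrite -!EFinB; congr (_%:E); ring.
Qed.

Lemma ge0_integral_shift (y : R) (f : R -> \bar R) :
  measurable_fun setT f -> (forall x, 0 <= f x) ->
  \int[mu]_x f (x - y)%R = \int[mu]_x f x.
Proof.
move=> mf f0.
have ms : measurable_fun setT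
    ((fun x => x - y)%R : measurableTypeR R -> measurableTypeR R).
  exact: measurable_funB.
have f0' : {in setT, forall x, 0 <= f x} by move=> x _.
have := @ge0_integral_pushforward _ _ (measurableTypeR R) (measurableTypeR R)
  R _ ms mu setT f measurableT mf f0'.
rewrite preimage_setT /comp => <-.
by apply: eq_measure_integral => A mA _; exact: lebesgue_measure_shift.
Qed.

Lemma integral_decay : \int[mu]_x (decay x)%:E = pi%:E.
Proof.
rewrite ge0_symfun_integralT//=.
- rewrite (_ : [set x | _] = `[0%R, +oo[%classic); last first.
    by apply/seteqP; split => x/=; rewrite in_itv/= andbT.
  by rewrite integral0y_oneDsqr -EFinM mulrC divfK.
- by move=> x; exact/ltW/decay_gt0.
- exact: continuous_decay.
- by move=> x/=; rewrite /decay /oneDsqr sqrrN.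
Qed.

Lemma integral_shift (y : R) (f : R -> \bar R) : measurable_fun setT f ->
  \int[mu]_x f (x - y)%R = \int[mu]_x f x.
Proof.
move=> mf; rewrite integralE [RHS]integralE; congr (_ - _).
- rewrite -(ge0_integral_shift y (f := f^\+)) //; last exact: measurable_funepos.
  by apply: eq_integral => x _; rewrite !funeposE.
- rewrite -(ge0_integral_shift y (f := f^\-)) //; last exact: measurable_funeneg.
  by apply: eq_integral => x _; rewrite !funenegE.
Qed.

Lemma integrable_decay : mu.-integrable setT (EFin \o @decay R).
Proof.
apply/integrableP; split; first by apply/measurable_EFinP; exact: measurable_decay.
under eq_integral do rewrite /= ger0_norm ?(ltW (decay_gt0 _))//.
by rewrite integral_decay ltry.
Qed.

Lemma cvg_decay (y : R) (u : nat -> R) : `|u n|%R @[n --> \oo] --> +oo%R ->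
  (decay (u n - y) @[n --> \oo] --> 0)%R.
Proof.
move=> uoo; apply/cvgrPdist_le => e e0; near=> n.
rewrite sub0r normrN ger0_norm; last exact/ltW/decay_gt0.
have un : (`|y| + e^-1 <= `|u n|)%R by near: n; exact: (cvgryPge _).1.
have zn : (e^-1 <= 1 + (u n - y) ^+ 2)%R.
  apply: (@le_trans _ _ `|u n - y|%R).
    by have := lerB_dist (u n) y; lra.
  by rewrite -(real_normK (num_real (u n - y)%R)); nra.
by rewrite invf_ple// posrE (lt_le_trans ltr01)// oneDsqr_ge1.
Unshelve. all: by end_near. Qed.

(** The fundamental theorem of calculus on [-n, n], in the limit by dominated
    convergence; this is why only integers matter in the hypotheses at
    infinity. *)
Lemma Rintegral_derive_eq0 (F f : R -> R) :
  (forall x : R, is_derive x 1%R F (f x)) -> continuous f ->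
  mu.-integrable setT (EFin \o f) ->
  (F n%:R @[n --> \oo] --> 0%R)%R ->
  (F (- n%:R) @[n --> \oo] --> 0%R)%R ->
  (\int[mu]_x f x = 0)%R.
Proof.
move=> dF cf intf Fp Fm.
pose fn (n : nat) x := (EFin \o (f \_ `[(- n%:R)%R, n%:R%R]%classic)) x.
have mfn n : measurable_fun setT (fn n).
  apply/measurable_EFinP/(measurable_restrictT _ _).1 => //.
  by apply/measurable_funTS; exact: continuous_measurable_fun.
have mf : measurable_fun setT (EFin \o f) by exact: measurable_int intf.
have fnf : {ae mu, forall x, setT x -> fn ^~ x @ \oo --> (EFin \o f) x}.
  apply: aeW => x _; apply: cvg_near_cst; near=> n.
  rewrite /fn /= patchE mem_set//= in_itv/= -ler_norml.
  by near: n; exact: nbhs_infty_ger.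
have fnle : {ae mu, forall x n, setT x -> `|fn n x| <= (abse \o (EFin \o f)) x}.
  apply: aeW => x n _; rewrite /fn /= patchE lee_fin.
  by case: ifPn => //; rewrite normr0.
have [_ _ cvgI] := @dominated_convergence _ _ _ mu _ measurableT _ _ _ mfn mf fnf
  (integrable_abse intf) fnle.
suff h : (fun n => \int[mu]_x fn n x) @ \oo --> 0%:E.
  by rewrite /Rintegral (cvg_unique _ cvgI h).
have E n : (0 < n)%N -> \int[mu]_x fn n x = (F n%:R - F (- n%:R))%:E.
  move=> n0; rewrite /fn -restrict_EFin -integral_mkcond.
  apply: continuous_FTC2.
  - by rewrite gtrN ?ltr0n.
  - exact: continuous_subspaceT.
  - have cF : continuous F by exact: derive_continuous dF.
    split => [x _||]; first by case: (dF x).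
    + by apply: cvg_at_right_filter; exact: cF.
    + by apply: cvg_at_left_filter; exact: cF.
  - by move=> x _; rewrite derive1E; case: (dF x) => _ ->.
have hc : (F n%:R - F (- n%:R))%:E @[n --> \oo] --> 0%:E.
  apply: cvg_EFin; first exact: nearW.
  by rewrite -(subr0 0%R); exact: cvgB.
apply: cvg_trans hc; apply: near_eq_cvg; near=> n; rewrite E//.
by near: n; exact: nbhs_infty_gt.
Unshelve. all: by end_near. Qed.

End lebesgue.

(** * The envelope *)

Section envelope.
Context d {T : measurableType d} {R : realType} (P : probability T R).
Variable Y : T -> R.
Hypothesis mY : measurable_fun setT Y.
Hypothesis Y2 : P.-integrable setT (fun w => (Y w ^+ 2)%:E).
Notation mu := (@lebesgue_measure R).

Lemma measurable_fun_shear (k : R -> R) : measurable_fun setT k ->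
  measurable_fun setT (fun z : T * R => k (z.2 - Y z.1)).
Proof.
move=> mk; apply: measurableT_comp => //; apply: measurable_funB => //.
exact: (measurableT_comp mY).
Qed.

(** By Tonelli's theorem and translation invariance, the integral of the envelope
    is [pi] times the mean of [1 + Y ^+ 2]. *)
Lemma integrable_envelope : mu.-integrable setT (EFin \o envelope P Y).
Proof.
have mE : measurable_fun setT (envelope P Y).
  by apply: continuous_measurable_fun; exact: continuous_envelope.
apply/integrableP; split; first exact/measurable_EFinP.
pose f (z : T * R) := ((1 + Y z.1 ^+ 2) * decay (z.2 - Y z.1))%:E.
have f0 z : (0 <= f z)%E.
  by rewrite lee_fin; have /andP[] := envelope_integrand_le Y z.2 z.1.
have mf : measurable_fun setT f.
  apply/measurable_EFinP/measurable_funM.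
    apply: measurable_funD => //; apply: measurable_funX.
    exact: (measurableT_comp mY).
  by apply: measurable_fun_shear; exact: measurable_decay.
have -> : (\int[mu]_x `|(EFin \o envelope P Y) x| =
    \int[mu]_x \int[P]_w f (w, x))%E.
  apply: eq_integral => x _ /=; rewrite ger0_norm ?envelope_ge0//.
  rewrite /envelope /Rintegral fineK//.
  by apply: integrable_fin_num => //; exact: integrable_envelope_integrand.
rewrite -(@fubini_tonelli _ _ _ _ _ P mu)//.
have -> : (\int[P]_x \int[mu]_y f (x, y) =
    \int[P]_w ((1 + Y w ^+ 2)%:E * pi%:E))%E.
  apply: eq_integral => w _; rewrite /f /=.
  under eq_integral do rewrite EFinM.
  rewrite ge0_integralZl//.
  - congr (_ * _)%E.
    rewrite (ge0_integral_shift (Y w) (f := fun x => (decay x)%:E)).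
    + by rewrite integral_decay.
    + by apply/measurable_EFinP; exact: measurable_decay.
    + by move=> x; rewrite lee_fin ltW// decay_gt0.
  - apply/measurable_EFinP/measurableT_comp => //.
      by exact: measurable_decay.
    exact: measurable_funB.
  - by move=> x _; rewrite lee_fin ltW// decay_gt0.
  - by rewrite lee_fin (le_trans _ (weight_ge1 Y w)).
rewrite integralZr//; last exact: integrable_weight.
have := integrable_fin_num measurableT (integrable_weight Y2).
by move=> /fineK <-; rewrite -EFinM ltry.
Qed.

Lemma cvg_envelope (u : nat -> R) : `|u n| @[n --> \oo] --> +oo ->
  envelope P Y (u n) @[n --> \oo] --> (0 : R).
Proof.
move=> uoo.
pose fn n w := ((1 + Y w ^+ 2) * decay (u n - Y w))%:E.
have mfn n : measurable_fun setT (fn n).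
  exact/measurable_EFinP/measurable_envelope_integrand.
have fn0 : {ae P, forall w, setT w -> fn ^~ w @ \oo --> cst 0%E w}.
  apply: aeW => w _; apply: cvg_EFin; first exact: nearW.
  rewrite -(mulr0 (1 + Y w ^+ 2)); apply: cvgM; first exact: cvg_cst.
  exact: cvg_decay.
have fnle : {ae P, forall w n, setT w -> (`|fn n w| <= (1 + Y w ^+ 2)%:E)%E}.
  apply: aeW => w n _; rewrite /fn lee_fin.
  by have /andP[h0 h1] := envelope_integrand_le Y (u n) w; rewrite ger0_norm.
have [_ _] := dominated_convergence measurableT mfn (measurable_cst _) fn0
  (integrable_weight Y2) fnle.
rewrite integral0; exact: fine_cvg.
Qed.

End envelope.

(** * Densities of random variables *)

Section density.
Context d {T : measurableType d} {R : realType} (P : probability T R).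
Notation mu := (@lebesgue_measure R).
Local Open Scope ereal_scope.
Import HBNNSimple.

Section change_of_variables.
Variables (X : T -> R) (f : R -> R).
Hypothesis mX : measurable_fun setT X.
Hypothesis Xf : is_density P X f.

Let mf : measurable_fun setT f. Proof. by case: Xf. Qed.
Let f0 x : (0 <= f x)%R. Proof. by case: Xf. Qed.

Let ge0_integral_density_nnsfun (h : {nnsfun R >-> R}) :
  \int[P]_w (h (X w))%:E = \int[mu]_x ((h x)%:E * (f x)%:E).
Proof.
have m1 r : measurable_fun setT (\1_(h @^-1` [set r]) : R -> R).
  by apply: measurable_indic; exact: measurable_sfunP.
under [LHS]eq_integral do rewrite fimfunE -fsumEFin//.
rewrite ge0_integral_fsum//; last 2 first.
- move=> r; apply/measurable_EFinP/measurableT_comp => //.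
  by apply: measurableT_comp => //; exact: m1.
- by move=> r w _; rewrite EFinM nnfun_muleindic_ge0.
under [RHS]eq_integral.
  move=> x _; rewrite fimfunE -fsumEFin// muleC ge0_mule_fsumr; last first.
    by move=> r; rewrite EFinM nnfun_muleindic_ge0.
  over.
rewrite [RHS]ge0_integral_fsum//; last 2 first.
- move=> r; apply/measurable_EFinP/measurable_funM => //.
  by apply: measurable_funM => //; exact: m1.
- move=> r x _; rewrite mule_ge0//; first by rewrite lee_fin.
  by rewrite EFinM nnfun_muleindic_ge0.
apply: eq_fsbigr => r /[!inE] -[x _ <-].
have hr : (0 <= h x)%R by [].
have mh : measurable (h @^-1` [set h x]) by exact: measurable_sfunP.
have mX' : measurable (X @^-1` (h @^-1` [set h x])).
  by rewrite -[X in measurable X]setTI; exact: mX.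
under eq_integral do rewrite EFinM.
rewrite ge0_integralZl//; last first.
  by apply/measurable_EFinP/measurableT_comp => //; exact: m1.
under [RHS]eq_integral do rewrite EFinM muleCA.
rewrite [RHS]ge0_integralZl//; last 2 first.
- apply: emeasurable_funM; first exact/measurable_EFinP.
  by apply/measurable_EFinP; exact: m1.
- by move=> y _; rewrite mule_ge0// lee_fin.
congr (_ * _).
have -> : \int[P]_w (\1_(h @^-1` [set h x]) (X w))%:E =
    P (X @^-1` (h @^-1` [set h x])).
  by rewrite -[in RHS](setIT (X @^-1` _)) -integral_indic.
case: Xf => _ _ -> //.
rewrite [LHS]integral_mkcond; apply: eq_integral => y _.
by rewrite patchE indicE; case: ifPn => _; rewrite ?mule1 ?mule0.
Qed.

Lemma ge0_integral_density (g : R -> \bar R) :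
  measurable_fun setT g -> (forall x, 0 <= g x) ->
  \int[P]_w g (X w) = \int[mu]_x (g x * (f x)%:E).
Proof.
move=> mg g0.
pose g_ := nnsfun_approx measurableT mg.
transitivity (limn (fun n => \int[P]_w (g_ n (X w))%:E)).
  rewrite -monotone_convergence//=.
  - apply: eq_integral => w _; apply/esym/cvg_lim => //.
    exact: cvg_nnsfun_approx.
  - by move=> n; apply/measurable_EFinP/measurableT_comp.
  - by move=> n w _; rewrite lee_fin.
  - by move=> w _ a b ab; rewrite lee_fin; exact/lefP/nd_nnsfun_approx.
under eq_fun do rewrite ge0_integral_density_nnsfun.
rewrite -monotone_convergence//=.
- apply: eq_integral => x _; apply/cvg_lim => //.
  by apply: cvgeZr => //; exact: cvg_nnsfun_approx.
- move=> n; apply: emeasurable_funM; apply/measurable_EFinP => //.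
  by have : measurable_fun setT (g_ n) by exact: measurable_funP.
- by move=> n w _; rewrite mule_ge0 ?lee_fin.
- move=> w _ a b ab; rewrite lee_wpmul2r ?lee_fin//.
  have /lefP gab := nd_nnsfun_approx measurableT mg ab.
  exact: gab.
Qed.

(** Positive and negative parts are transferred separately; the integral is their
    difference on both sides. *)
Lemma integral_density (g : R -> R) : measurable_fun setT g ->
  \int[P]_w (g (X w))%:E = \int[mu]_x (g x * f x)%:E.
Proof.
move=> mg; rewrite integralE [RHS]integralE; congr (_ - _).
- transitivity (\int[P]_w (EFin \o g)^\+ (X w)).
    by apply: eq_integral => w _; rewrite !funeposE.
  rewrite (ge0_integral_density (g := (EFin \o g)^\+)) //; last first.
    by apply: measurable_funepos; exact/measurable_EFinP.
  apply: eq_integral => x _.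
  by rewrite !funeposE /= maxe_pMl ?lee_fin// mul0e EFinM.
- transitivity (\int[P]_w (EFin \o g)^\- (X w)).
    by apply: eq_integral => w _; rewrite !funenegE.
  rewrite (ge0_integral_density (g := (EFin \o g)^\-)) //; last first.
    by apply: measurable_funeneg; exact/measurable_EFinP.
  apply: eq_integral => x _.
  by rewrite !funenegE /= maxe_pMl ?lee_fin// mul0e -EFinM mulNr.
Qed.

End change_of_variables.

(** A density is determined almost everywhere, and a set of full Lebesgue
    measure is dense. *)
Lemma continuous_density_unique (X : T -> R) (f g : R -> R) :
  is_density P X f -> is_density P X g -> continuous f -> continuous g -> f = g.
Proof.
move=> [mf f0 Pf] [mg g0 Pg] cf cg.
have intf : mu.-integrable setT (EFin \o f).
  apply/integrableP; split; first exact/measurable_EFinP.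
  under eq_integral do rewrite /= ger0_norm//.
  by rewrite -Pf// ltey_eq fin_num_measure// preimage_setT.
have fg : ae_eq mu setT (EFin \o f) (EFin \o g).
  apply: integral_ae_eq => //; first exact/measurable_EFinP.
  by move=> E _ mE; rewrite -Pf// -Pg.
case: fg => N [mN N0 subN]; apply/funext => x; apply: contrapT => /eqP fgx.
have ch : continuous (fun x => f x - g x)%R.
  by move=> y; apply: cvgB; [exact: cf|exact: cg].
have fgx' : (f x - g x != 0)%R by rewrite subr_eq0.
have [e /= e0 xe] := cvgr_neq0 _ (ch x) fgx'.
have : mu (ball x e) <= mu N.
  apply: le_measure; rewrite ?inE//; first exact: measurable_ball.
  move=> y /xe /eqP fgy; apply: subN => /= /(_ I) [] /eqP.
  by rewrite -subr_eq0 => /eqP.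
rewrite lebesgue_measure_ball ?(ltW e0)// [X in _ <= X]N0 lee_fin leNgt.
by rewrite mulrn_wgt0.
Qed.

(** By independence the joint law is a product, so that the probability of
    [Y + B \in A] is the mean of the probability that [B] lies in [A - Y w], an
    integral of the translate [f (x - Y w)] over [A]; Tonelli's theorem then
    exchanges the two integrals. The bound on [f] makes [smooth P Y f] finite,
    and continuity makes it measurable. *)
Lemma is_density_add (Y B : {RV P >-> R}) (f : R -> R) (C : R) :
  (forall A D : set R, measurable A -> measurable D ->
    P (Y @^-1` A `&` B @^-1` D) = P (Y @^-1` A) * P (B @^-1` D)) ->
  is_density P B f -> continuous f -> (forall x, `|f x| <= C)%R ->
  is_density P (fun w => Y w + B w)%R (smooth P Y f).
Proof.
move=> indep [mf f0 Bf] cf fC.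
have cs : continuous (smooth P Y f) by exact: continuous_smooth fC.
split; first exact: continuous_measurable_fun.
  by move=> x; apply: Rintegral_ge0 => w _; exact: f0.
move=> A mA.
have m1A : measurable_fun setT (\1_A : R -> R) by exact: measurable_indic.
pose Z w := (Y w, B w).
have mZ : measurable_fun setT Z by exact: measurable_fun_pair.
pose S := [set z : R * R | A (z.1 + z.2)%R].
have mS : measurable S.
  rewrite -[X in measurable X]setTI.
  have mD : measurable_fun setT (fun z : R * R => z.1 + z.2)%R.
    exact: measurable_funD.
  exact: mD.
have -> : P ((fun w => Y w + B w)%R @^-1` A) = pushforward P Z S by [].
have joint := @product_measure_unique _ _ _ _ _ (distribution P Y)
  (distribution P B) (pushforward P Z) indep S mS.
rewrite -(joint mZ) /product_measure1.
rewrite ge0_integral_distribution//; last first.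
  exact: measurable_fun_xsection.
transitivity (\int[P]_w \int[mu]_x ((\1_A x)%:E * (f (x - Y w))%:E)).
  apply: eq_integral => w _ /=.
  rewrite /distribution /pushforward.
  have mAw : measurable (xsection S (Y w)) by exact: measurable_xsection.
  rewrite Bf// integral_mkcond.
  rewrite -[RHS](ge0_integral_shift (- Y w)); last 2 first.
  - apply: emeasurable_funM; apply/measurable_EFinP; first exact: m1A.
    by apply: measurableT_comp => //; exact: measurable_funB.
  - by move=> x; rewrite mule_ge0// lee_fin.
  apply: eq_integral => x _; rewrite opprK addrK patchE -EFinM.
  rewrite indicE; case: ifPn => xS.
    rewrite (mem_set (_ : A (x + Y w)%R)) ?mul1r// addrC.
    by rewrite /xsection/= inE/= in xS; exact: set_mem xS.
  rewrite (memNset (_ : ~ A (x + Y w)%R)) ?mul0r// addrC => AYx.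
  by move/negP: xS; apply; rewrite /xsection/= inE/=; exact: mem_set.
rewrite (@fubini_tonelli _ _ _ _ _ P mu
  (fun z => (\1_A z.2)%:E * (f (z.2 - Y z.1))%:E)); last 2 first.
- apply: emeasurable_funM; apply/measurable_EFinP.
    exact: (measurableT_comp m1A).
  by apply: measurable_fun_shear => //; exact: measurable_funP.
- by move=> z; rewrite mule_ge0// lee_fin.
rewrite [RHS]integral_mkcond; apply: eq_integral => x _.
rewrite patchE /=.
have intx := integrable_smooth P (measurable_funP Y) x mf fC.
rewrite integralZl//.
rewrite indicE; case: ifPn => _; rewrite ?mul0e// mul1e.
by rewrite fineK//; exact: integrable_fin_num.
Qed.

End density.

(** * Uniform decay of the Gaussian kernels *)

Section real_integrable.
Context d {T : measurableType d} {R : realType} (nu : {measure set T -> \bar R}).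
Implicit Types f g : T -> R.

Lemma integrable_EFinZ (r : R) f : nu.-integrable setT (EFin \o f) ->
  nu.-integrable setT (EFin \o (fun w => r * f w)).
Proof.
move=> fi; apply: (eq_integrable measurableT (fun w => (r%:E * (f w)%:E)%E)) => //.
exact: integrableZl.
Qed.

Lemma integrable_EFinD f g : nu.-integrable setT (EFin \o f) ->
  nu.-integrable setT (EFin \o g) ->
  nu.-integrable setT (EFin \o (fun w => f w + g w)).
Proof.
move=> fi gi.
apply: (eq_integrable measurableT (fun w => ((f w)%:E + (g w)%:E)%E)) => //.
exact: integrableD.
Qed.

Lemma integrable_EFinB f g : nu.-integrable setT (EFin \o f) ->
  nu.-integrable setT (EFin \o g) ->
  nu.-integrable setT (EFin \o (fun w => f w - g w)).
Proof.
move=> fi gi.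
apply: (eq_integrable measurableT (fun w => ((f w)%:E - (g w)%:E)%E)) => //.
exact: integrableB.
Qed.

End real_integrable.

Section gaussian_kernel_bounds.
Context {R : realType}.
Implicit Types (v z a b : R).

(** One of the three powers of [decay] in [gauss_decay] pays for a factor of
    quadratic growth. The constant [1 + a^-1 + a^-2] dominates the coefficients of
    all the polynomial factors that differentiation brings down, for variances at
    least [a]. *)
Lemma gauss_quadratic_decay a b : 0 < a -> exists C, 0 <= C /\
  forall v z q, a <= v <= b -> `|q| <= (1 + a^-1 + a^-2) * (1 + z ^+ 2) ->
    `|q * gauss v z| <= C * decay z ^+ 2.
Proof.
move=> a0; have [C [C0 gC]] := gauss_decay b a0.
have K0 : 0 <= 1 + a^-1 + a^-2.
  by rewrite !addr_ge0// invr_ge0 ?exprn_ge0// ltW.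
exists ((1 + a^-1 + a^-2) * C); split; first exact: mulr_ge0.
move=> v z q vab qz; rewrite normrM (gtr0_norm (gauss_gt0 v z)).
have z0 : 0 <= 1 + z ^+ 2 by rewrite addr_ge0 ?sqr_ge0.
apply: (le_trans (ler_pM _ (ltW (gauss_gt0 _ _)) qz (gC v z vab))) => //.
have -> : (1 + a^-1 + a^-2) * (1 + z ^+ 2) * (C * decay z ^+ 3) =
    (1 + a^-1 + a^-2) * C * decay z ^+ 2 * (decay z * (1 + z ^+ 2)) by ring.
by rewrite decayM_oneDsqr mulr1.
Qed.

Lemma gauss1_quadratic a v z : 0 < a -> a <= v ->
  `|- (z / v)| <= (1 + a^-1 + a^-2) * (1 + z ^+ 2).
Proof.
move=> a0 av; have v0 := lt_le_trans a0 av.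
have ai : 0 < a^-1 by rewrite invr_gt0.
have vi : v^-1 <= a^-1 by rewrite lef_pV2.
have vi0 : 0 < v^-1 by rewrite invr_gt0.
rewrite normrN normrM (gtr0_norm vi0) -exprVn.
have z1 : `|z| <= 1 + z ^+ 2.
  by rewrite -(real_normK (num_real z)); nra.
apply: (@le_trans _ _ ((1 + z ^+ 2) * a^-1)).
  by apply: ler_pM => //; exact: ltW.
by rewrite mulrC ler_wpM2r ?addr_ge0 ?sqr_ge0//; nra.
Qed.

Lemma gauss_sqr_quadratic a v z : 0 < a -> a <= v ->
  `|z ^+ 2 / v ^+ 2| <= (1 + a^-1 + a^-2) * (1 + z ^+ 2).
Proof.
move=> a0 av; have v0 := lt_le_trans a0 av.
have ai : 0 < a^-1 by rewrite invr_gt0.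
have vi : v^-1 <= a^-1 by rewrite lef_pV2.
have vi0 : 0 < v^-1 by rewrite invr_gt0.
rewrite -!exprVn ger0_norm; last by apply: mulr_ge0; exact: sqr_ge0.
have v2 : v^-1 ^+ 2 <= a^-1 ^+ 2 by apply: lerXn2r; rewrite // nnegrE ltW.
have := sqr_ge0 z; have := sqr_ge0 a^-1.
move: (z ^+ 2) (v^-1 ^+ 2) (a^-1 ^+ 2) v2 => Z V A v2 A0 Z0.
have ZV : Z * V <= Z * A by rewrite ler_wpM2l.
have Za : 0 <= Z * a^-1 by rewrite mulr_ge0// ltW.
have -> : (1 + a^-1 + A) * (1 + Z) = 1 + a^-1 + A + Z + Z * a^-1 + Z * A by ring.
lra.
Qed.

Lemma gauss2_quadratic a v z : 0 < a -> a <= v ->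
  `|z ^+ 2 / v ^+ 2 - v^-1| <= (1 + a^-1 + a^-2) * (1 + z ^+ 2).
Proof.
move=> a0 av; have v0 := lt_le_trans a0 av.
have ai : 0 < a^-1 by rewrite invr_gt0.
have vi : v^-1 <= a^-1 by rewrite lef_pV2.
have vi0 : 0 < v^-1 by rewrite invr_gt0.
have v2 : v^-1 ^+ 2 <= a^-1 ^+ 2 by apply: lerXn2r; rewrite // nnegrE ltW.
rewrite -!exprVn.
have := sqr_ge0 z; have := sqr_ge0 a^-1; have := sqr_ge0 v^-1.
move: (z ^+ 2) (v^-1 ^+ 2) (a^-1 ^+ 2) v2 => Z V A v2 V0 A0 Z0.
have ZV : Z * V <= Z * A by rewrite ler_wpM2l.
have ZV0 : 0 <= Z * V by rewrite mulr_ge0.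
have Za : 0 <= Z * a^-1 by rewrite mulr_ge0// ltW.
have -> : (1 + a^-1 + A) * (1 + Z) = 1 + a^-1 + A + Z + Z * a^-1 + Z * A by ring.
by rewrite ler_norml; apply/andP; split; lra.
Qed.

Lemma one_quadratic a z : 0 < a -> `|1| <= (1 + a^-1 + a^-2) * (1 + z ^+ 2).
Proof.
move=> a0; have ai : 0 < a^-1 by rewrite invr_gt0.
by rewrite normr1 -exprVn; have := sqr_ge0 z; have := sqr_ge0 a^-1; nra.
Qed.

Lemma continuous_gauss v : continuous (gauss v).
Proof. exact: derive_continuous (is_derive_gauss v). Qed.

Lemma continuous_gauss1 v : continuous (gauss1 v).
Proof. exact: derive_continuous (is_derive_gauss1 v). Qed.

Lemma continuous_gauss2 v : continuous (gauss2 v).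
Proof.
move=> z; apply: cvgM; last exact: continuous_gauss.
apply: cvgB; last exact: cvg_cst.
by apply: cvgMl; exact: exprn_continuous.
Qed.

Lemma continuous_gauss_sqr v : continuous (fun z => z ^+ 2 / v ^+ 2 * gauss v z).
Proof.
move=> z; apply: cvgM; last exact: continuous_gauss.
by apply: cvgMl; exact: exprn_continuous.
Qed.

Lemma kernels_decay a b : 0 < a -> exists C, 0 <= C /\
  forall v z, a <= v <= b -> [/\ `|gauss v z| <= C * decay z ^+ 2,
    `|gauss1 v z| <= C * decay z ^+ 2,
    `|gauss2 v z| <= C * decay z ^+ 2 &
    `|z ^+ 2 / v ^+ 2 * gauss v z| <= C * decay z ^+ 2].
Proof.
move=> a0; have [C [C0 hC]] := gauss_quadratic_decay b a0.
exists C; split=> // v z vab; have /andP[av vb] := vab; split.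
- by rewrite -[gauss v z]mul1r; apply: hC => //; exact: one_quadratic.
- by apply: hC => //; exact: gauss1_quadratic.
- by apply: hC => //; exact: gauss2_quadratic.
- by apply: hC => //; exact: gauss_sqr_quadratic.
Qed.

Lemma kernels_decay1 v : 0 < v -> exists C, 0 <= C /\
  forall z, [/\ `|gauss v z| <= C * decay z ^+ 2,
    `|gauss1 v z| <= C * decay z ^+ 2,
    `|gauss2 v z| <= C * decay z ^+ 2 &
    `|z ^+ 2 / v ^+ 2 * gauss v z| <= C * decay z ^+ 2].
Proof.
move=> v0; have [C [C0 hC]] := kernels_decay v v0.
by exists C; split => // z; apply: hC; rewrite lexx.
Qed.

Lemma decay2_le1 (z : R) : decay z ^+ 2 <= 1.
Proof. by have := decay_gt0 z; have := decay_le1 z; nra. Qed.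

Lemma decaying_bounded (k : R -> R) (C z : R) : 0 <= C ->
  `|k z| <= C * decay z ^+ 2 -> `|k z| <= C.
Proof. by move=> C0 /le_trans; apply; rewrite ler_piMr// decay2_le1. Qed.

End gaussian_kernel_bounds.

(** * Gaussian mixtures *)

Section gaussian_mixture.
Context d {T : measurableType d} {R : realType} (P : probability T R).
Variable Y : T -> R.
Hypothesis mY : measurable_fun setT Y.
Hypothesis Y2 : P.-integrable setT (fun w => (Y w ^+ 2)%:E).
Notation mu := (@lebesgue_measure R).
Implicit Types (v x a b : R).

Definition mixture v x := smooth P Y (gauss v) x.
Definition mixture1 v x := smooth P Y (gauss1 v) x.
Definition mixture2 v x := smooth P Y (gauss2 v) x.

Lemma is_derive_mixture v x : 0 < v ->
  is_derive x 1 (mixture v) (mixture1 v x).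
Proof.
move=> v0; have [C [C0 hC]] := kernels_decay1 v0.
apply: (is_derive_smooth P mY x (C := C)) => z.
- exact: is_derive_gauss.
- by have [h _ _ _] := hC z; exact: (decaying_bounded C0 h).
- by have [_ h _ _] := hC z; exact: (decaying_bounded C0 h).
Qed.

Lemma is_derive_mixture1 v x : 0 < v ->
  is_derive x 1 (mixture1 v) (mixture2 v x).
Proof.
move=> v0; have [C [C0 hC]] := kernels_decay1 v0.
apply: (is_derive_smooth P mY x (C := C)) => z.
- exact: is_derive_gauss1.
- by have [_ h _ _] := hC z; exact: (decaying_bounded C0 h).
- by have [_ _ h _] := hC z; exact: (decaying_bounded C0 h).
Qed.

Lemma continuous_mixture2 v : 0 < v -> continuous (mixture2 v).
Proof.
move=> v0; have [C [C0 hC]] := kernels_decay1 v0.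
apply: (@continuous_smooth _ _ _ P _ mY (gauss2 v) C).
  exact: continuous_gauss2.
by move=> z; have [_ _ h _] := hC z; exact: (decaying_bounded C0 h).
Qed.

Lemma is_derive_mixture_variance v x : 0 < v ->
  is_derive v 1 (mixture ^~ x) (mixture2 v x / 2).
Proof.
(* the kernels are uniformly bounded only for variances in a compact part of
   the open half-line *)
move=> v0; have a0 : 0 < v / 2 by rewrite divr_gt0.
have [C [C0 hC]] := kernels_decay (2 * v) a0.
have vab u : v / 2 < u < 2 * v -> v / 2 <= u <= 2 * v.
  by move=> /andP[h1 h2]; rewrite !ltW.
have mg2 : measurable_fun setT (gauss2 v).
  by apply: continuous_measurable_fun; exact: continuous_gauss2.
have vI : v / 2 < v < 2 * v by apply/andP; split; lra.
have hC2 z : `|gauss2 v z| <= C.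
  by have [_ _ h _] := hC v z (vab _ vI); exact: (decaying_bounded C0 h).
have i2 := integrable_smooth P mY x mg2 hC2.
have -> : mixture2 v x / 2 = \int[P]_w (gauss2 v (x - Y w) / 2).
  by rewrite RintegralZr.
apply: (@is_derive_Rintegral _ _ _ _ (fun v w => gauss v (x - Y w))
  (fun v w => gauss2 v (x - Y w) / 2) (fun=> C) v (v / 2) (2 * v)).
- exact: vI.
- move=> u uI; apply: (integrable_smooth P mY x (C := C)).
    by apply: continuous_measurable_fun; exact: continuous_gauss.
  by move=> z; have [h _ _ _] := hC u z (vab _ uI); exact: (decaying_bounded C0 h).
- move=> u w /andP[u1 _]; apply: is_derive_gauss_variance.
  exact: lt_trans u1.
- exact: finite_measure_integrable_cst.
- move=> u w uI; have [_ _ h _] := hC u (x - Y w) (vab _ uI).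
  rewrite normrM (ger0_norm (_ : 0 <= 2^-1)) ?invr_ge0//.
  have := decaying_bounded C0 h; lra.
Qed.

Lemma integrable_gauss_smooth v x : 0 < v ->
  P.-integrable setT (EFin \o (fun w => gauss v (x - Y w))).
Proof.
move=> v0; have [C [C0 hC]] := kernels_decay1 v0.
apply: (integrable_smooth P mY x (C := C)).
  by apply: continuous_measurable_fun; exact: continuous_gauss.
by move=> z; have [h _ _ _] := hC z; exact: (decaying_bounded C0 h).
Qed.

Lemma Rintegral_probability_cst (r : R) : \int[P]_w r = r.
Proof. by rewrite Rintegral_cst// [X in fine X]probability_setT mulr1. Qed.

Let m2 := \int[P]_w (Y w ^+ 2).

(** Jensen's inequality for [expR], through the tangent line
    [expR c * (1 + s - c) <= expR s]. As [(x - y) ^+ 2] is at most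
    [2 * x ^+ 2 + 2 * y ^+ 2], the exponent of the kernel is bounded below by an
    affine function of [Y ^+ 2], and [c] is the mean of that function. *)
Lemma mixture_lower_bound a b v x : 0 < a -> a <= v <= b ->
  expR (- (((2 * x ^+ 2 + 2 * m2) / a + ln (pi *+ 2 * b)) / 2)) <= mixture v x.
Proof.
move=> a0 /andP[av vb]; have v0 := lt_le_trans a0 av.
set L := ln (pi *+ 2 * b); set c := - (_ / 2).
have ai : 0 < a^-1 by rewrite invr_gt0.
pose g w := expR c * (1 + m2 / a) - expR c / a * Y w ^+ 2.
have ig2 : P.-integrable setT (EFin \o (fun w => expR c / a * Y w ^+ 2)).
  exact: integrable_EFinZ.
have ig1 : P.-integrable setT (EFin \o (fun=> expR c * (1 + m2 / a))).
  exact: finite_measure_integrable_cst.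
have ig : P.-integrable setT (EFin \o g).
  exact: integrable_EFinB.
have -> : expR c = \int[P]_w g w.
  rewrite /g RintegralB// [X in X - _]Rintegral_probability_cst.
  rewrite RintegralZl// -/m2; ring.
apply: le_Rintegral => //; first exact: integrable_gauss_smooth.
move=> w _; rewrite /g.
have -> : expR c * (1 + m2 / a) - expR c / a * Y w ^+ 2 =
    expR c * (1 + (m2 - Y w ^+ 2) / a) by ring.
rewrite /gauss; set s := - (_ / 2).
have -> : s = c + (s - c) by ring.
rewrite expRD ler_wpM2l ?expR_ge0//.
apply: le_trans (expR_ge1Dx _); rewrite lerD2l.
have Lb : ln (pi *+ 2 * v) <= L.
  have pi2 : 0 < pi *+ 2 :> R by rewrite mulrn_wgt0// pi_gt0.
  by rewrite ler_ln ?posrE ?mulr_gt0 ?ler_pM2l// (lt_le_trans v0).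
have xy : (x - Y w) ^+ 2 / v <= (2 * x ^+ 2 + 2 * Y w ^+ 2) / a.
  apply: (@le_trans _ _ ((x - Y w) ^+ 2 / a)).
    by rewrite ler_wpM2l ?sqr_ge0// lef_pV2.
  rewrite ler_wpM2r ?(ltW ai)//.
  by have := sqr_ge0 (x + Y w); nra.
rewrite /s /c; move: xy Lb; set G := _ / v; set l := ln (pi *+ 2 * v) => xy Lb.
have -> : (2 * x ^+ 2 + 2 * m2) / a = (2 * x ^+ 2 + 2 * Y w ^+ 2) / a +
  2 * ((m2 - Y w ^+ 2) / a) by ring.
lra.
Qed.

Lemma mixture_gt0 v x : 0 < v -> 0 < mixture v x.
Proof.
move=> v0; apply: (lt_le_trans (expR_gt0 _)).
by apply: (mixture_lower_bound x v0 (b := v)); rewrite lexx.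
Qed.

(** Stated for [1 + ln], the derivative of [u * ln u], which is the factor that
    occurs in the derivative of the entropy. *)
Lemma ln_mixture_bound a b : 0 < a -> exists C, 0 <= C /\
  forall v x, a <= v <= b -> `|1 + ln (mixture v x)| <= C * (1 + x ^+ 2).
Proof.
move=> a0; have [C [C0 hC]] := kernels_decay b a0.
have ai : 0 < a^-1 by rewrite invr_gt0.
set L := ln (pi *+ 2 * b).
have m20 : 0 <= m2 by apply: Rintegral_ge0 => w _; exact: sqr_ge0.
exists (1 + `|ln C| + a^-1 + m2 / a + `|L|); split.
  by rewrite !addr_ge0// ?mulr_ge0// ltW.
move=> v x vab; have /andP[av vb] := vab; have v0 := lt_le_trans a0 av.
have p0 := mixture_gt0 x v0.
have pC : mixture v x <= C.
  rewrite -(Rintegral_probability_cst C).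
  apply: le_Rintegral => //; first exact: integrable_gauss_smooth.
    exact: finite_measure_integrable_cst.
  move=> w _; have [h _ _ _] := hC v (x - Y w) vab.
  by apply: le_trans (decaying_bounded C0 h); exact: ler_norm.
have up : ln (mixture v x) <= `|ln C|.
  apply: le_trans (ler_norm _).
  by rewrite ler_ln ?posrE// (lt_le_trans p0).
have lo : - (((2 * x ^+ 2 + 2 * m2) / a + L) / 2) <= ln (mixture v x).
  by rewrite -[leLHS]expRK ler_ln ?posrE ?expR_gt0//; exact: mixture_lower_bound.
have Ll := ler_norm L; have L0 := normr_ge0 L; have C1 := normr_ge0 (ln C).
have x0 := sqr_ge0 x.
have ma0 : 0 <= m2 / a by rewrite mulr_ge0// ltW.
have xa0 : 0 <= x ^+ 2 * a^-1 by rewrite mulr_ge0// ltW.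
have lo' : - (x ^+ 2 * a^-1 + m2 / a + `|L|) <= ln (mixture v x).
  apply: le_trans lo; rewrite lerN2.
  have -> : (2 * x ^+ 2 + 2 * m2) / a = 2 * (x ^+ 2 * a^-1 + m2 / a) by ring.
  lra.
apply: (@le_trans _ _ (1 + `|ln C| + a^-1 + m2 / a + `|L| + x ^+ 2 * a^-1)).
  by rewrite ler_norml; apply/andP; split; lra.
rewrite mulrDr mulr1 lerD2l mulrC ler_wpM2r//.
lra.
Qed.

(** The Cauchy-Schwarz inequality for the law of [Y] weighted by the kernel: the
    square of [z / v + l] has a nonnegative mean for every [l], and the choice of
    the score [l = mixture1 v x / mixture v x] minimizes it. *)
Lemma score_mixture_bound v x : 0 < v ->
  mixture1 v x ^+ 2 / mixture v x <=
  smooth P Y (fun z => z ^+ 2 / v ^+ 2 * gauss v z) x.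
Proof.
move=> v0; have [C [C0 hC]] := kernels_decay1 v0.
have p0 := mixture_gt0 x v0.
set p := mixture v x in p0 *; set p1 := mixture1 v x; set q := smooth _ _ _ _.
have i0 := integrable_gauss_smooth x v0.
have i1 : P.-integrable setT (EFin \o (fun w => gauss1 v (x - Y w))).
  apply: (integrable_smooth P mY x (C := C)).
    by apply: continuous_measurable_fun; exact: continuous_gauss1.
  by move=> z; have [_ h _ _] := hC z; exact: (decaying_bounded C0 h).
pose k z := z ^+ 2 / v ^+ 2 * gauss v z.
have i2 : P.-integrable setT (EFin \o (fun w => k (x - Y w))).
  apply: (integrable_smooth P mY x (C := C)).
    by apply: continuous_measurable_fun; exact: continuous_gauss_sqr.
  by move=> z; have [_ _ _ h] := hC z; exact: (@decaying_bounded _ k).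
pose l := p1 / p.
have : 0 <= \int[P]_w (k (x - Y w) + (- (2 * l) * gauss1 v (x - Y w) +
    l ^+ 2 * gauss v (x - Y w))).
  apply: Rintegral_ge0 => w _; rewrite /k /gauss1; set z := x - Y w.
  have -> : z ^+ 2 / v ^+ 2 * gauss v z + (- (2 * l) * (- (z / v) * gauss v z) +
    l ^+ 2 * gauss v z) = (z / v + l) ^+ 2 * gauss v z.
    by rewrite -exprVn; ring.
  by rewrite mulr_ge0 ?sqr_ge0// ltW// gauss_gt0.
rewrite RintegralD//; last first.
  by apply: integrable_EFinD; exact: integrable_EFinZ.
rewrite RintegralD//; [|exact: integrable_EFinZ..].
rewrite !RintegralZl// -/(smooth P Y k x) -/q.
rewrite -/(smooth P Y (gauss v) x) -/(mixture v x) -/p.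
rewrite -/(smooth P Y (gauss1 v) x) -/(mixture1 v x) -/p1.
have -> : q + (- (2 * l) * p1 + l ^+ 2 * p) = q - p1 ^+ 2 / p.
  by rewrite /l; field; rewrite gt_eqF.
by rewrite subr_ge0.
Qed.

Lemma integrable_envelope_bound (f : R -> R) C : continuous f ->
  (forall x, `|f x| <= C * envelope P Y x) -> mu.-integrable setT (EFin \o f).
Proof.
move=> cf fC; have iE := integrable_envelope mY Y2.
have mf : measurable_fun setT f by exact: continuous_measurable_fun.
apply: (@le_integrable _ _ _ mu _ measurableT _
  (EFin \o (fun x => C * envelope P Y x))).
- exact/measurable_EFinP.
- by move=> x _; rewrite /= lee_fin (le_trans (fC x))// ler_norm.
- exact: integrable_EFinZ.
Qed.
End gaussian_mixture.

(** * The identity of de Bruijn *)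

Section de_bruijn.
Context d {T : measurableType d} {R : realType} (P : probability T R).
Variable Y : T -> R.
Hypothesis mY : measurable_fun setT Y.
Hypothesis Y2 : P.-integrable setT (fun w => (Y w ^+ 2)%:E).
Notation mu := (@lebesgue_measure R).
Implicit Types (v x a b : R).
Notation p := (mixture P Y).
Notation p1 := (mixture1 P Y).
Notation p2 := (mixture2 P Y).
Notation env := (envelope P Y).

Lemma continuous_mixture v : 0 < v -> continuous (p v).
Proof. by move=> v0; apply: derive_continuous => x; exact: is_derive_mixture. Qed.

Lemma continuous_mixture1 v : 0 < v -> continuous (p1 v).
Proof. by move=> v0; apply: derive_continuous => x; exact: is_derive_mixture1. Qed.

Lemma is_derive_ln_mixture v x : 0 < v ->
  is_derive x 1 (fun x => ln (p v x)) (p1 v x / p v x).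
Proof.
move=> v0; rewrite mulrC.
have H1 := is_derive1_ln (mixture_gt0 mY Y2 x v0).
have H2 := is_derive_mixture P mY x v0.
exact: (is_derive1_comp H1 H2).
Qed.

Lemma continuous_ln_mixture v : 0 < v -> continuous (fun x => ln (p v x)).
Proof.
move=> v0; exact: (derive_continuous (fun x => is_derive_ln_mixture x v0)).
Qed.

(** The decay of the kernels absorbs the quadratic growth of [ln (p v x)]. The
    bounds are, in order, for the entropy, for the boundary terms of the
    integration by parts, and for the two integrals that it relates. *)
Lemma mixture_envelope_bounds a b : 0 < a -> exists C, 0 <= C /\
  forall v x, a <= v <= b ->
  [/\ `|p v x * ln (p v x)| <= C * env x,
      `|p1 v x * (1 + ln (p v x))| <= C * env x,
      `|p2 v x * (1 + ln (p v x))| <= C * env x &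
      `|p1 v x ^+ 2 / p v x| <= C * env x].
Proof.
move=> a0; have [K [K0 hK]] := kernels_decay b a0.
have [L [L0 hL]] := ln_mixture_bound mY Y2 b a0.
exists (2 * K * (L + 1)); split; first by rewrite !mulr_ge0 ?addr_ge0.
move=> v x vab; have /andP[av vb] := vab; have v0 := lt_le_trans a0 av.
have lnb := hL v x vab.
have x0 := sqr_ge0 x.
have weighted (k : R -> R) (l : R) : continuous k ->
    (forall z, `|k z| <= K * decay z ^+ 2) -> `|l| <= (L + 1) * (1 + x ^+ 2) ->
    `|smooth P Y k x * l| <= 2 * K * (L + 1) * env x.
  move=> ck kK lL; rewrite normrM.
  have mk : measurable_fun setT k by exact: continuous_measurable_fun.
  have h := smooth_envelope mY Y2 x mk K0 kK.
  apply: (@le_trans _ _ (`|smooth P Y k x| * ((L + 1) * (1 + x ^+ 2)))).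
    by rewrite ler_wpM2l.
  rewrite mulrCA [leRHS](_ : _ = (L + 1) * (2 * K * env x)); last by ring.
  by rewrite ler_wpM2l// addr_ge0.
have lnb1 : `|1 + ln (p v x)| <= (L + 1) * (1 + x ^+ 2).
  by apply: (le_trans lnb); nra.
have lnb0 : `|ln (p v x)| <= (L + 1) * (1 + x ^+ 2).
  have := ler_normB (1 + ln (p v x)) 1; rewrite addrAC subrr add0r normr1 => h.
  by apply: (le_trans h); nra.
split.
- apply: (weighted (gauss v)) => //; first exact: continuous_gauss.
  by move=> z; have [] := hK v z vab.
- apply: (weighted (gauss1 v)) => //; first exact: continuous_gauss1.
  by move=> z; have [] := hK v z vab.
- apply: (weighted (gauss2 v)) => //; first exact: continuous_gauss2.
  by move=> z; have [] := hK v z vab.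
- have p0 := mixture_gt0 mY Y2 x v0.
  rewrite ger0_norm; last by rewrite mulr_ge0 ?sqr_ge0// invr_ge0 ltW.
  apply: (le_trans (score_mixture_bound mY Y2 x v0)).
  apply: (le_trans (ler_norm _)); rewrite -[X in `|X|]mulr1.
  apply: (weighted (fun z => z ^+ 2 / v ^+ 2 * gauss v z)).
  + exact: continuous_gauss_sqr.
  + by move=> z; have [] := hK v z vab.
  + by rewrite normr1; nra.
Qed.

Lemma integrable_mixture_ln v : 0 < v ->
  mu.-integrable setT (EFin \o (fun x => p v x * ln (p v x))).
Proof.
move=> v0; have [C [C0 hC]] := mixture_envelope_bounds v v0.
apply: (integrable_envelope_bound mY Y2 (C := C)).
  by move=> x; apply: cvgM; [exact: continuous_mixture|exact: continuous_ln_mixture].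
by move=> x; have [] := hC v x; rewrite ?lexx.
Qed.

Lemma continuous_score_sqr v : 0 < v -> continuous (fun x => p1 v x ^+ 2 / p v x).
Proof.
move=> v0 x; apply: cvgM.
  apply: (@continuous_comp _ _ _ (p1 v) (fun y => y ^+ 2)).
    exact: continuous_mixture1.
  exact: exprn_continuous.
apply: cvgV; last exact: continuous_mixture.
by rewrite gt_eqF// mixture_gt0.
Qed.

Lemma integrable_mixture_fisher v : 0 < v ->
  mu.-integrable setT (EFin \o (fun x => p1 v x ^+ 2 / p v x)).
Proof.
move=> v0; have [C [C0 hC]] := mixture_envelope_bounds v v0.
apply: (integrable_envelope_bound mY Y2 (C := C)).
  exact: continuous_score_sqr.
by move=> x; have [] := hC v x; rewrite ?lexx.
Qed.

Definition mixture_entropy v := - \int[mu]_x (p v x * ln (p v x)).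
Definition mixture_fisher v := \int[mu]_x (p1 v x ^+ 2 / p v x).

(** Integration by parts over the line: [p1 * (1 + ln p)] vanishes at infinity,
    and its derivative is the sum of the two integrands. *)
Lemma integral_heat_ln v : 0 < v ->
  \int[mu]_x (p2 v x * (1 + ln (p v x))) = - mixture_fisher v.
Proof.
move=> v0; have [C [C0 hC]] := mixture_envelope_bounds v v0.
have vv : v <= v <= v by rewrite lexx.
have c1 : continuous (fun x => p2 v x * (1 + ln (p v x))).
  move=> x; apply: cvgM; first exact: continuous_mixture2.
  by apply: cvgD; [exact: cvg_cst|exact: continuous_ln_mixture].
have i1 : mu.-integrable setT (EFin \o (fun x => p2 v x * (1 + ln (p v x)))).
  apply: (integrable_envelope_bound mY Y2 (C := C)) => // x.
  by have [] := hC v x vv.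
have i2 := integrable_mixture_fisher v0.
have cvgF (u : nat -> R) : `|u n| @[n --> \oo] --> +oo ->
    (p1 v (u n) * (1 + ln (p v (u n)))) @[n --> \oo] --> (0 : R).
  move=> uoo; apply: norm_cvg0.
  apply: (@squeeze_cvgr _ _ _ _ (cst 0) (fun n => C * env (u n))).
  - by apply: nearW => n; rewrite normr_ge0/=; have [] := hC v (u n) vv.
  - exact: cvg_cst.
  - by rewrite -(mulr0 C); apply: cvgM; [exact: cvg_cst|exact: cvg_envelope].
pose F x := p1 v x * (1 + ln (p v x)).
pose f x := p2 v x * (1 + ln (p v x)) + p1 v x ^+ 2 / p v x.
have dF x : is_derive x 1 F (f x).
  have d1 := is_derive_mixture1 P mY x v0.
  have d2 := is_derive_ln_mixture x v0.
  by apply: is_derive_eq; rewrite /GRing.scale/= /f; ring.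
have cf : continuous f.
  by move=> x; apply: cvgD; [exact: c1|exact: continuous_score_sqr].
have intf : mu.-integrable setT (EFin \o f) by exact: integrable_EFinD.
have := Rintegral_derive_eq0 dF cf intf (cvgF _ (@cvg_normr_nat R))
  (cvgF _ (@cvg_normr_natN R)).
rewrite RintegralD// => h; rewrite /mixture_fisher; lra.
Qed.

(** By the heat equation the derivative of [p * ln p] in [v] is half of
    [p2 * (1 + ln p)], to which the integration by parts applies. *)
Theorem de_bruijn v : 0 < v ->
  is_derive v 1 mixture_entropy (mixture_fisher v / 2).
Proof.
move=> v0; have a0 : 0 < v / 2 by rewrite divr_gt0.
have [C [C0 hC]] := mixture_envelope_bounds (2 * v) a0.
have vab u : v / 2 < u < 2 * v -> v / 2 <= u <= 2 * v.
  by move=> /andP[h1 h2]; rewrite !ltW.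
have vI : v / 2 < v < 2 * v by apply/andP; split; lra.
have iE := integrable_envelope mY Y2.
have D : is_derive v 1 (fun v => \int[mu]_x (p v x * ln (p v x)))
    (\int[mu]_x (2^-1 * (p2 v x * (1 + ln (p v x))))).
  apply: (@is_derive_Rintegral _ _ _ mu (fun v x => p v x * ln (p v x))
    (fun v x => 2^-1 * (p2 v x * (1 + ln (p v x)))) (fun x => C * env x)
    v (v / 2) (2 * v)).
  - exact: vI.
  - by move=> u /andP[u1 _]; apply: integrable_mixture_ln; exact: lt_trans u1.
  - move=> u x /andP[u1 _]; have u0 := lt_trans a0 u1.
    have p0 := mixture_gt0 mY Y2 x u0.
    have d1 := is_derive_mixture_variance P mY x u0.
    have d2 : is_derive u 1 (fun v => ln (p v x)) ((p u x)^-1 * (p2 u x / 2)).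
      exact: (@is_derive1_comp _ (@ln R) (fun v => p v x) u _ _
        (is_derive1_ln p0) d1).
    apply: is_derive_eq; rewrite /GRing.scale/=; field.
    by rewrite gt_eqF.
  - exact: integrable_EFinZ.
  - move=> u x uI; have [_ _ h _] := hC u x (vab u uI).
    rewrite normrM (ger0_norm (_ : 0 <= 2^-1)) ?invr_ge0//.
    by have := normr_ge0 (p2 u x * (1 + ln (p u x))); lra.
have -> : mixture_fisher v / 2 =
    - \int[mu]_x (2^-1 * (p2 v x * (1 + ln (p v x)))).
  rewrite RintegralZl ?integral_heat_ln//; first by ring.
  apply: (integrable_envelope_bound mY Y2 (C := C)).
    move=> x; apply: cvgM; first exact: continuous_mixture2.
    by apply: cvgD; [exact: cvg_cst|exact: continuous_ln_mixture].
  by move=> x; have [] := hC v x (vab v vI).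
exact: is_deriveN D.
Qed.

End de_bruijn.

(** * Moments and convolution of the Gaussian kernel *)

Section gaussian_moments.
Context {R : realType}.
Notation mu := (@lebesgue_measure R).
Implicit Types (v z : R).

Lemma decaying_le (k : R -> R) (C z : R) : 0 <= C ->
  `|k z| <= C * decay z ^+ 2 -> `|k z| <= C * decay z.
Proof.
move=> C0 /le_trans; apply; rewrite ler_wpM2l//.
by have := decay_gt0 z; have := decay_le1 z; nra.
Qed.

Lemma integrable_decaying (k : R -> R) (C : R) : continuous k -> 0 <= C ->
  (forall z, `|k z| <= C * decay z ^+ 2) -> mu.-integrable setT (EFin \o k).
Proof.
move=> ck C0 kC; have mk : measurable_fun setT k by exact: continuous_measurable_fun.
have iC : mu.-integrable setT (EFin \o (fun x => C * decay x)).
  exact/integrable_EFinZ/integrable_decay.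
apply: (@le_integrable _ _ _ mu _ measurableT _ _ _ _ iC).
- exact/measurable_EFinP.
- by move=> x _; rewrite /= lee_fin (le_trans (decaying_le C0 (kC x)))// ler_norm.
Qed.

Lemma cvg_decaying (k : R -> R) (C : R) (u : nat -> R) : 0 <= C ->
  (forall z, `|k z| <= C * decay z ^+ 2) -> `|u n| @[n --> \oo] --> +oo ->
  k (u n) @[n --> \oo] --> (0 : R).
Proof.
move=> C0 kC uoo; apply: norm_cvg0.
apply: (@squeeze_cvgr _ _ _ _ (cst 0) (fun n => C * decay (u n))).
- by apply: nearW => n; rewrite normr_ge0/= decaying_le.
- exact: cvg_cst.
- rewrite -(mulr0 C); apply: cvgM; first exact: cvg_cst.
  have := cvg_decay 0 uoo; rewrite /=; by under eq_fun do rewrite subr0.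
Qed.

Lemma integrable_gauss v : 0 < v -> mu.-integrable setT (EFin \o gauss v).
Proof.
move=> /kernels_decay1[C [C0 hC]]; apply: (integrable_decaying _ C0).
  exact: continuous_gauss.
by move=> z; have [] := hC z.
Qed.

Lemma integrable_gauss_sqr v : 0 < v ->
  mu.-integrable setT (EFin \o (fun z => z ^+ 2 / v ^+ 2 * gauss v z)).
Proof.
move=> /kernels_decay1[C [C0 hC]]; apply: (integrable_decaying _ C0).
  exact: continuous_gauss_sqr.
by move=> z; have [] := hC z.
Qed.

Lemma integrable_gauss1 v : 0 < v -> mu.-integrable setT (EFin \o gauss1 v).
Proof.
move=> /kernels_decay1[C [C0 hC]]; apply: (integrable_decaying _ C0).
  exact: continuous_gauss1.
by move=> z; have [] := hC z.
Qed.

Lemma Rintegral_gauss v : 0 < v -> \int[mu]_z gauss v z = 1.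
Proof.
move=> v0; have s0 : Num.sqrt v != 0 by rewrite gt_eqF// sqrtr_gt0.
rewrite /Rintegral -[RHS]/(fine 1%E) -(integral_normal_pdf 0 (Num.sqrt v)).
congr fine; apply: eq_integral => z _.
by rewrite normal_pdf_gauss// sqr_sqrtr ?(ltW v0)// subr0.
Qed.

Lemma Rintegral_gauss1 v : 0 < v -> \int[mu]_z gauss1 v z = 0.
Proof.
move=> v0; have [C [C0 hC]] := kernels_decay1 v0.
have gC z : `|gauss v z| <= C * decay z ^+ 2 by have [] := hC z.
apply: (Rintegral_derive_eq0 (is_derive_gauss v)).
- exact: continuous_gauss1.
- exact: integrable_gauss1.
- exact: (cvg_decaying C0 gC cvg_normr_nat).
- exact: (cvg_decaying C0 gC cvg_normr_natN).
Qed.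

Lemma Rintegral_gauss_mean v : 0 < v -> \int[mu]_z (z * gauss v z) = 0.
Proof.
move=> v0.
have -> : \int[mu]_z (z * gauss v z) = \int[mu]_z (- v * gauss1 v z).
  by apply: eq_Rintegral => z _; rewrite /gauss1; field; rewrite gt_eqF.
by rewrite RintegralZl ?Rintegral_gauss1 ?mulr0//; exact: integrable_gauss1.
Qed.

(** The Fisher information of the normal law; it is read off the vanishing of the
    integral of the second derivative [gauss2]. *)
Lemma Rintegral_gauss_sqr v : 0 < v ->
  \int[mu]_z (z ^+ 2 / v ^+ 2 * gauss v z) = v^-1.
Proof.
move=> v0; have [C [C0 hC]] := kernels_decay1 v0.
have gC z : `|gauss1 v z| <= C * decay z ^+ 2 by have [] := hC z.
have i2 : mu.-integrable setT (EFin \o gauss2 v).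
  apply: (integrable_decaying _ C0); first exact: continuous_gauss2.
  by move=> z; have [] := hC z.
have := Rintegral_derive_eq0 (is_derive_gauss1 v) (@continuous_gauss2 _ v) i2
  (cvg_decaying C0 gC cvg_normr_nat) (cvg_decaying C0 gC cvg_normr_natN).
have -> : \int[mu]_z gauss2 v z =
    \int[mu]_z (z ^+ 2 / v ^+ 2 * gauss v z - v^-1 * gauss v z).
  by apply: eq_Rintegral => z _; rewrite /gauss2 mulrBl.
rewrite RintegralB//; last 2 first.
- exact: integrable_gauss_sqr.
- exact/integrable_EFinZ/integrable_gauss.
rewrite RintegralZl ?Rintegral_gauss ?mulr1//; last exact: integrable_gauss.
by move/eqP; rewrite subr_eq0 => /eqP.
Qed.

Lemma Rintegral_gauss_variance v : 0 < v -> \int[mu]_z (z ^+ 2 * gauss v z) = v.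
Proof.
move=> v0.
have -> : \int[mu]_z (z ^+ 2 * gauss v z) =
    \int[mu]_z (v ^+ 2 * (z ^+ 2 / v ^+ 2 * gauss v z)).
  by apply: eq_Rintegral => z _; field; rewrite gt_eqF.
rewrite RintegralZl ?Rintegral_gauss_sqr//; last exact: integrable_gauss_sqr.
by field; rewrite gt_eqF.
Qed.

(** Completing the square in [y]: the conditional law of a normal variable, given
    its sum with an independent one, is normal again. *)
Lemma gauss_mul_gauss (a v x y : R) : 0 < a -> 0 < v ->
  gauss v (x - y) * gauss a y =
  gauss (a + v) x * gauss (a * v / (a + v)) (y - a * x / (a + v)).
Proof.
move=> a0 v0; have av0 : 0 < a + v by rewrite addr_gt0.
rewrite /gauss -!expRD; congr expR.
have pi2 : 0 < pi *+ 2 :> R by rewrite mulrn_wgt0// pi_gt0.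
have lnM2 (u : R) : 0 < u -> ln (pi *+ 2 * u) = ln (pi *+ 2) + ln u.
  by move=> u0; rewrite lnM ?posrE.
rewrite !lnM2 ?divr_gt0 ?mulr_gt0// ln_div ?posrE ?mulr_gt0// lnM ?posrE//.
set l := ln (pi *+ 2).
by field; rewrite !gt_eqF.
Qed.

Lemma Rintegral_gauss_convolution (a v x : R) : 0 < a -> 0 < v ->
  \int[mu]_y (gauss v (x - y) * gauss a y) = gauss (a + v) x.
Proof.
move=> a0 v0; have av0 : 0 < a + v by rewrite addr_gt0.
have w0 : 0 < a * v / (a + v) by rewrite divr_gt0 ?mulr_gt0.
set w := a * v / (a + v) in w0; set c := a * x / (a + v).
have -> : \int[mu]_y (gauss v (x - y) * gauss a y) =
    \int[mu]_y (gauss (a + v) x * gauss w (y - c)).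
  by apply: eq_Rintegral => y _; rewrite gauss_mul_gauss.
have mg : measurable_fun setT (gauss w).
  by apply: continuous_measurable_fun; exact: continuous_gauss.
have mg' : measurable_fun setT (fun y => (gauss w y)%:E) by exact/measurable_EFinP.
rewrite /Rintegral.
under eq_integral do rewrite EFinM.
rewrite ge0_integralZl//; last 3 first.
- apply/measurable_EFinP/measurableT_comp => //; exact: measurable_funB.
- by move=> y _; rewrite lee_fin ltW// gauss_gt0.
- by rewrite lee_fin ltW// gauss_gt0.
rewrite (integral_shift c mg').
have ig := integrable_gauss w0.
rewrite fineM ?integrable_fin_num//= -/(Rintegral mu setT (gauss w)).
by rewrite Rintegral_gauss// mulr1.
Qed.

End gaussian_moments.

(** * Gaussian random variables *)

Section gaussian_law.
Context d {T : measurableType d} {R : realType} (P : probability T R).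
Notation mu := (@lebesgue_measure R).

Lemma gaussian_dirac_ae (X : T -> R) (m : R) : measurable_fun setT X ->
  is_gaussian P X m 0 -> {ae P, forall w, setT w -> X w = m}.
Proof.
move=> mX gX; have mA : measurable (~` [set m]) by exact: measurableC.
have mXA : measurable (X @^-1` (~` [set m])).
  by rewrite -[X in measurable X]setTI; exact: mX.
exists (X @^-1` (~` [set m])); split=> //.
  by rewrite (gX _ mA) eqxx diracE memNset//= => /(_ erefl).
by move=> w /= Xw; apply: contra_not Xw.
Qed.

Lemma is_density_gaussian (X : T -> R) (m s : R) : s != 0 ->
  is_gaussian P X m s -> is_density P X (normal_pdf m s).
Proof.
move=> s0 gX; split.
- exact: measurable_normal_pdf.
- by move=> x; exact: normal_pdf_ge0.
- by move=> A mA; rewrite gX// (negbTE s0).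
Qed.

(** The first two moments single out a law among the Gaussian ones, and a positive
    variance excludes the Dirac masses. *)
Lemma gaussian_density_of_moments (X : {RV P >-> R}) (m s v : R) : 0 < v ->
  is_gaussian P X m s -> ('E_P[X] = 0)%E ->
  ('E_P[fun w => (X w ^+ 2)%R] = v%:E)%E ->
  is_density P X (gauss v).
Proof.
move=> v0 gX; rewrite unlock => EX EX2.
have mX : measurable_fun setT X by exact: measurable_funP.
have [s0|s0] := eqVneq s 0.
  rewrite s0 in gX; have Xm := gaussian_dirac_ae mX gX.
  have Ecst (g : R -> R) : measurable_fun setT g ->
      (\int[P]_w (g (X w))%:E = (g m)%:E)%E.
    move=> mg; rewrite -[RHS](_ : (\int[P]_w (g m)%:E = _)%E); last first.
      by rewrite integral_cst// [X in (_ * X)%E]probability_setT mule1.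
    apply: ae_eq_integral => //.
    - by apply/measurable_EFinP; exact: measurableT_comp.
    - by apply: filterS Xm => w Xw _; rewrite Xw.
  have m0 : m = 0 by move: EX; rewrite (Ecst id)// => -[].
  have := EX2; rewrite (Ecst (fun x => x ^+ 2) (exprn_measurable 2)) m0 expr0n/=.
  by move=> -[vv]; move: v0; rewrite -vv ltxx.
have Xd := is_density_gaussian s0 gX.
have s20 : 0 < s ^+ 2 by rewrite exprn_even_gt0.
have E (g : R -> R) : measurable_fun setT g ->
    (\int[P]_w (g (X w))%:E = \int[mu]_z (g (z + m) * gauss (s ^+ 2) z)%:E)%E.
  move=> mg; rewrite (integral_density mX Xd mg).
  have mf : measurable_fun setT (fun z : R => (g (z + m) * gauss (s ^+ 2) z)%:E).
    apply/measurable_EFinP/measurable_funM.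
      by apply: measurableT_comp => //; exact: measurable_funD.
    by apply: continuous_measurable_fun; exact: continuous_gauss.
  rewrite -(integral_shift m mf); apply: eq_integral => x _.
  by rewrite subrK normal_pdf_gauss.
have i1 : mu.-integrable setT (EFin \o (fun z => z * gauss (s ^+ 2) z)).
  have -> : (fun z => z * gauss (s ^+ 2) z) =
      (fun z => - (s ^+ 2) * gauss1 (s ^+ 2) z).
    by apply/funext => z; rewrite /gauss1; field.
  exact/integrable_EFinZ/integrable_gauss1.
have m0 : m = 0.
  have : fine (\int[P]_w (X w)%:E) = 0 by rewrite EX.
  rewrite (E id)//.
  have -> : (\int[mu]_z ((z + m) * gauss (s ^+ 2) z)%:E =
      \int[mu]_z (z * gauss (s ^+ 2) z + m * gauss (s ^+ 2) z)%:E)%E.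
    by apply: eq_integral => z _; rewrite mulrDl.
  rewrite -/(Rintegral mu setT _) RintegralD//; last first.
    exact/integrable_EFinZ/integrable_gauss.
  rewrite Rintegral_gauss_mean// add0r RintegralZl ?Rintegral_gauss ?mulr1//.
  exact: integrable_gauss.
have sv : s ^+ 2 = v.
  have : fine (\int[P]_w (X w ^+ 2)%:E) = v by rewrite EX2.
  rewrite (E (fun z => z ^+ 2)); last exact: exprn_measurable.
  rewrite -/(Rintegral mu setT _) m0.
  have -> : \int[mu]_z ((z + 0) ^+ 2 * gauss (s ^+ 2) z) =
      \int[mu]_z (z ^+ 2 * gauss (s ^+ 2) z).
    by apply: eq_Rintegral => z _; rewrite addr0.
  by rewrite Rintegral_gauss_variance.
have -> : gauss v = normal_pdf m s.
  by apply/funext => x; rewrite normal_pdf_gauss// sv m0 subr0.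
exact: Xd.
Qed.

End gaussian_law.

(** * Entropy and Fisher information of a perturbed variable *)

Section information_of_mixture.
Context d {T : measurableType d} {R : realType} (P : probability T R).

Lemma density_eq (X : T -> R) (f : R -> R) :
  is_differentiable_density P X f -> density P X = f.
Proof.
have derc (g : R -> R) : (forall x, derivable g x 1) -> continuous g.
  by move=> dg x; apply/differentiable_continuous/derivable1_diffP.
move=> Xf; rewrite /density asboolT; last by exists f.
have : is_differentiable_density P X (get (is_differentiable_density P X)).
  exact: (getI Xf).
case: Xf => Xf df [Xg dg].
by apply: (continuous_density_unique Xg Xf); exact: derc.
Qed.

Variable Y : {RV P >-> R}.
Hypothesis Y2 : P.-integrable setT (fun w => (Y w ^+ 2)%:E).
Variables (B : {RV P >-> R}) (v : R).
Hypothesis v0 : 0 < v.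
Hypothesis indep : forall A D : set R, measurable A -> measurable D ->
    (P (Y @^-1` A `&` B @^-1` D) = P (Y @^-1` A) * P (B @^-1` D))%E.
Hypothesis Bv : is_density P B (gauss v).
Let X w := Y w + B w.
Let mY : measurable_fun setT Y. Proof. exact: measurable_funP. Qed.
Let mX : measurable_fun setT X.
Proof. by apply: measurable_funD; exact: measurable_funP. Qed.

Lemma is_differentiable_density_mixture :
  is_differentiable_density P X (mixture P Y v).
Proof.
have [C [C0 hC]] := kernels_decay1 v0.
split; last by move=> x; case: (is_derive_mixture P mY x v0).
have gC z : `|gauss v z| <= C.
  by have [h _ _ _] := hC z; exact: (decaying_bounded C0 h).
exact: (is_density_add indep Bv (@continuous_gauss _ v) gC).
Qed.

Let Xv : is_density P X (mixture P Y v).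
Proof. by case: is_differentiable_density_mixture. Qed.

Lemma shannon_entropy_mixture :
  shannon_entropy P X = (mixture_entropy P Y v)%:E.
Proof.
rewrite /shannon_entropy (density_eq is_differentiable_density_mixture) unlock.
have ml : measurable_fun setT (fun x => ln (mixture P Y v x)).
  by apply: continuous_measurable_fun; exact: continuous_ln_mixture.
rewrite (integral_density mX Xv ml) /mixture_entropy EFinN; congr (- _)%E.
have ip := integrable_mixture_ln mY Y2 v0.
rewrite /Rintegral fineK; last exact: integrable_fin_num.
by apply: eq_integral => x _; rewrite mulrC.
Qed.

Lemma fisher_information_mixture :
  fisher_information P X = (mixture_fisher P Y v)%:E.
Proof.
rewrite /fisher_information (density_eq is_differentiable_density_mixture).
rewrite unlock.
have E x : derive1 (fun x => ln (mixture P Y v x)) x =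
    mixture1 P Y v x / mixture P Y v x.
  by rewrite derive1E; case: (is_derive_ln_mixture mY Y2 x v0) => _ ->.
have ms : measurable_fun setT
    (fun x => (derive1 (fun x => ln (mixture P Y v x)) x) ^+ 2).
  apply: measurable_funX.
  rewrite (_ : derive1 _ = fun x => mixture1 P Y v x / mixture P Y v x); last exact/funext.
  apply: continuous_measurable_fun => x; apply: cvgM.
    exact: continuous_mixture1.
  apply: cvgV; last exact: continuous_mixture.
  by rewrite gt_eqF// mixture_gt0.
rewrite (integral_density mX Xv ms) /mixture_fisher.
have ip := integrable_mixture_fisher mY Y2 v0.
rewrite /Rintegral fineK; last exact: integrable_fin_num.
apply: eq_integral => x _; rewrite E; congr (_%:E).
by field; rewrite gt_eqF// mixture_gt0.
Qed.

End information_of_mixture.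

(** * Gaussian initial law *)

Section gaussian_initial_law.
Context d {T : measurableType d} {R : realType} (P : probability T R).
Variable Y : {RV P >-> R}.

Lemma mixture_gaussian (s v x : R) : 0 < v -> is_gaussian P Y 0 s ->
  mixture P Y v x = gauss (s ^+ 2 + v) x.
Proof.
move=> v0 gY; have mY : measurable_fun setT Y by exact: measurable_funP.
have mg : measurable_fun setT (fun y : R => gauss v (x - y)).
  apply: measurableT_comp; last exact: measurable_funB.
  by apply: continuous_measurable_fun; exact: continuous_gauss.
rewrite /mixture /smooth; have [s0|s0] := eqVneq s 0.
  rewrite s0 in gY *; rewrite expr0n/= add0r.
  rewrite -[RHS](Rintegral_probability_cst P); congr fine.
  apply: ae_eq_integral => //.
  - by apply/measurable_EFinP; apply: (measurableT_comp mg).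
  - apply: filterS (gaussian_dirac_ae mY gY) => w Yw _.
    by rewrite Yw// subr0.
have s20 : 0 < s ^+ 2 by rewrite exprn_even_gt0.
rewrite -Rintegral_gauss_convolution//; congr fine.
rewrite (integral_density mY (is_density_gaussian s0 gY) mg).
by apply: eq_integral => y _; rewrite normal_pdf_gauss// subr0.
Qed.

Lemma mixture_fisher_gaussian (s v : R) : 0 < v -> is_gaussian P Y 0 s ->
  mixture_fisher P Y v = (s ^+ 2 + v)^-1.
Proof.
move=> v0 gY; have mY : measurable_fun setT Y by exact: measurable_funP.
have w0 : 0 < s ^+ 2 + v by rewrite ltr_wpDl ?sqr_ge0.
have pE : mixture P Y v = gauss (s ^+ 2 + v).
  by apply/funext => x; exact: mixture_gaussian.
have p1E x : mixture1 P Y v x = gauss1 (s ^+ 2 + v) x.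
  case: (is_derive_mixture P mY x v0) => _ <-.
  by rewrite pE; case: (is_derive_gauss (s ^+ 2 + v) x) => _ <-.
rewrite -Rintegral_gauss_sqr// /mixture_fisher; apply: eq_Rintegral => x _.
rewrite pE p1E /gauss1; field.
by rewrite (gt_eqF (gauss_gt0 _ _)) gt_eqF.
Qed.

End gaussian_initial_law.

(** * Fractional Brownian motion *)

Section fractional_brownian_motion.
Context d {T : measurableType d} {R : realType} (P : probability T R).
Variables (H : R) (B : R -> {RV P >-> R}).

Lemma fBm_density (t : R) : 0 < H -> fractional_brownian_motion H B -> 0 < t ->
  is_density P (B t) (gauss (t `^ (2 * H))).
Proof.
move=> H0 [gB cB _ covB] t0.
have [m [s Bms]] := gB 1%N (fun=> t) (fun=> 1) (fun=> ltW t0).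
have E : (fun w => \sum_(i < 1) 1 * B t w) = B t.
  by apply/funext => w; rewrite big_ord1 mul1r.
rewrite E in Bms.
apply: (gaussian_density_of_moments (powR_gt0 _ t0) Bms (cB t (ltW t0))).
have -> : (fun w => B t w ^+ 2) = (fun w => B t w * B t w) by [].
(* on the diagonal the covariance is the second moment [t `^ (2 * H)] *)
rewrite covB ?(ltW t0)// subrr normr0 powR0; last by rewrite mulf_neq0// gt_eqF.
by rewrite subr0 -mulr2n -[_ *+ 2]mulr_natr mulfK.
Qed.

Lemma independent_of_process_at (Y : {RV P >-> R}) (t : R) (A D : set R) :
  independent_of_process Y B -> 0 <= t -> measurable A -> measurable D ->
  (P (Y @^-1` A `&` B t @^-1` D) = P (Y @^-1` A) * P (B t @^-1` D))%E.
Proof.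
move=> indep t0 mA mD; apply: indep.
  by exists A => //; rewrite setTI.
apply: sub_gen_smallest; exists t => //.
by exists D => //; rewrite setTI.
Qed.

End fractional_brownian_motion.

Unset Implicit Arguments.

Theorem theorem2p3 (d : measure_display) (T : measurableType d) (R : realType)
    (P : probability T R) (H : R) (B : R -> {RV P >-> R}) (X0 : {RV P >-> R})
    (H_gt0 : 0 < H) (H_lt1 : H < 1)
    (fBm_B : fractional_brownian_motion H B)
    (indep_X0_B : independent_of_process X0 B)
    (X0_sq : ('E_P[fun w => (X0 w ^+ 2)%R] < +oo)%E) :
  let X (t : R) (w : T) : R := X0 w + B t w in
  (forall t : R, 0 < t ->
    [/\ exists f : R -> R, is_differentiable_density P (X t) f,
        shannon_entropy P (X t) \is a fin_num,
        fisher_information P (X t) \is a fin_num &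
        is_derive t (1 : R) (fun u : R => fine (shannon_entropy P (X u)))
          (H * t `^ (2 * H - 1) * fine (fisher_information P (X t)))]) /\
  (forall s0 : R, is_gaussian P X0 0 s0 ->
    forall t : R, 0 < t ->
      is_derive t (1 : R) (fun u : R => fine (shannon_entropy P (X u)))
        (H * t `^ (2 * H - 1) / (s0 ^+ 2 + t `^ (2 * H)))).
Proof.
move=> X.
have mX0 : measurable_fun setT X0 by exact: measurable_funP.
have X02 : P.-integrable setT (fun w => (X0 w ^+ 2)%:E).
  apply/integrableP; split; first by apply/measurable_EFinP; exact: measurable_funX.
  move: X0_sq; rewrite unlock; under [X in _ -> (X < _)%E]eq_integral.
    by move=> w _; rewrite gee0_abs ?lee_fin ?sqr_ge0//; over.
  by [].
have v_gt0 (t : R) : 0 < t -> 0 < t `^ (2 * H) by exact: powR_gt0.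
have indep (t : R) (t0 : 0 < t) A D mA mD :=
  @independent_of_process_at _ _ _ _ _ _ t A D indep_X0_B (ltW t0) mA mD.
have Bd (t : R) (t0 : 0 < t) := fBm_density H_gt0 fBm_B t0.
have ent (t : R) : 0 < t ->
    shannon_entropy P (X t) = (mixture_entropy P X0 (t `^ (2 * H)))%:E.
  move=> t0; exact: (shannon_entropy_mixture X02 (v_gt0 t t0) (indep t t0)
    (Bd t t0)).
have fis (t : R) : 0 < t ->
    fisher_information P (X t) = (mixture_fisher P X0 (t `^ (2 * H)))%:E.
  move=> t0; exact: (fisher_information_mixture X02 (v_gt0 t t0) (indep t t0)
    (Bd t t0)).
have dent (t : R) : 0 < t ->
    is_derive t 1 (fun u : R => fine (shannon_entropy P (X u)))
    (H * t `^ (2 * H - 1) * mixture_fisher P X0 (t `^ (2 * H))).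
  move=> t0; apply: (@near_eq_is_derive _ _ _
    (fun u => mixture_entropy P X0 (u `^ (2 * H)))).
    near=> u; have u0 : 0 < u by near: u; exact: lt_nbhsr.
    by rewrite ent.
  have -> : H * t `^ (2 * H - 1) * mixture_fisher P X0 (t `^ (2 * H)) =
    (mixture_fisher P X0 (t `^ (2 * H)) / 2) * (2 * H * t `^ (2 * H - 1)) by field.
  exact: (@is_derive1_comp _ (mixture_entropy P X0) (fun u => u `^ (2 * H)) t _ _
    (de_bruijn mX0 X02 (v_gt0 t t0)) (is_derive1_powR (2 * H) t0)).
split=> [t t0|s0 gX0 t t0].
  split.
  - exists (mixture P X0 (t `^ (2 * H))).
    exact: (is_differentiable_density_mixture (v_gt0 t t0) (indep t t0) (Bd t t0)).
  - by rewrite (ent t t0).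
  - by rewrite (fis t t0).
  - by rewrite (fis t t0); exact: dent.
rewrite -(mixture_fisher_gaussian (v_gt0 t t0) gX0).
exact: dent.
Unshelve. all: by end_near. Qed.
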